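(* Let $L_1,K_1,\ldots,K_n\in\mathcal S^n$ and $\phi\in\mathcal C$. Then $$\phi(1)\ \ge\ \phi\left(\left(\frac{V(K_1)\cdots V(K_n)}{\widetilde V(K_1\widehat+_\phi L_1,K_2,\ldots,K_n)^n}\right)^{1/n}\right)+\phi\left(\left(\frac{V(L_1)V(K_2)\cdots V(K_n)}{\widetilde V(K_1\widehat+_\phi L_1,K_2,\ldots,K_n)^n}\right)^{1/n}\right).$$ If $\phi$ is strictly convex, equality holds if and only if $L_1,K_1,\ldots,K_n$ are all dilates of each other.
   Context: $\mathcal S^n$ is the set of star bodies (about the origin) in $\mathbb R^n$: compact sets $K$, star-shaped with respect to the origin, whose radial function $\rho(K,u)=\max\{c\ge 0: cu\in K\}$, $u\in S^{n-1}$, is positive and continuous. Two star bodies $K,L$ are dilates if $\rho(K,u)/\rho(L,u)$ is independent of $u\in S^{n-1}$. $S$ denotes spherical Lebesgue measure on $S^{n-1}$. $\mathcal C$ is the class of convex, decreasing functions $\phi:(0,\infty)\to(0,\infty)$ with $\lim_{t\to 0^+}\phi(t)=\infty$ (convention $\phi(0)=\infty$) and $\lim_{t\to\infty}\phi(t)=0$. $V$ is $n$-dimensional volume, $V(K)=\frac1n\int_{S^{n-1}}\rho(K,u)^n\,dS(u)$. The dual mixed volume of $K_1,\ldots,K_n\in\mathcal S^n$ is $\widetilde V(K_1,\ldots,K_n)=\frac1n\int_{S^{n-1}}\rho(K_1,u)\cdots\rho(K_n,u)\,dS(u)$. For $K,L\in\mathcal S^n$, the Orlicz harmonic radial sum $K\widehat+_\phi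 L$ is the star body $M$ whose radial function is determined by $$\phi\left(\frac{\rho(K,u)}{\rho(M,u)}\right)+\phi\left(\frac{\rho(L,u)}{\rho(M,u)}\right)=\phi(1),\qquad u\in S^{n-1}.$$ *)

(* Defs.v *)
From mathcomp Require Import all_boot all_order all_algebra.
From mathcomp Require Import all_classical all_reals all_analysis.
Import Order.TTheory GRing.Theory Num.Theory.
Import numFieldNormedType.Exports.

Set Implicit Arguments.
Unset Strict Implicit.
Unset Printing Implicit Defensive.

Local Open Scope classical_set_scope.
Local Open Scope ring_scope.

Section EuclideanSpace.
Variables (R : realType) (n : nat).

(* The norm `|v| of the library on row vectors is the sup norm. *)
Definition enorm (v : 'rV[R]_n) : R := Num.sqrt (\sum_i v 0 i ^+ 2).

Definition unit_sphere : set 'rV[R]_n := [set u | enorm u = 1].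

Definition borel_rV := g_sigma_algebraType (@open 'rV[R]_n).

End EuclideanSpace.

(* n-dimensional Lebesgue measure (on Borel sets) as an iterated product:
   the measure of A is the integral over x of the (n-1)-dimensional measure of
   the slice of A where the first coordinate equals x. *)
Fixpoint lebesgue_rV (R : realType) (n : nat) : set 'rV[R]_n -> \bar R :=
  match n with
  | 0 => fun A => (\1_A (0 : 'rV[R]_0))%:E
  | m.+1 => fun A => (\int[lebesgue_measure]_x
      lebesgue_rV [set v : 'rV[R]_m | A (row_mx (x : R)%:M v)])%E
  end.

Definition unit_cone (R : realType) (n : nat) (A : set 'rV[R]_n) : set 'rV[R]_n :=
  [set x | exists (r : R) (u : 'rV[R]_n),
    [/\ 0 < r <= 1, unit_sphere u, A u & x = r *: u]].

(* Spherical Lebesgue measure, via polar coordinates: S(A) is n times the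
   n-dimensional volume of the cone { r u : u in A, 0 < r <= 1 }. *)
Definition sphere_measure (R : realType) (n : nat) (A : set (borel_rV R n)) :
    \bar R :=
  (n%:R%:E * lebesgue_rV (unit_cone A))%E.

Definition sphere_integral (R : realType) (n : nat) (f : 'rV[R]_n -> R) : R :=
  fine (\int[@sphere_measure R n]_(u in @unit_sphere R n) (f u)%:E)%E.

Section StarBodies.
Variables (R : realType) (n : nat).
Implicit Types (K L M : set 'rV[R]_n) (phi : R -> R).

(* For a star body the supremum is attained. *)
Definition radial K (u : 'rV[R]_n) : R := sup [set c | 0 <= c /\ K (c *: u)].

Definition star_shaped K :=
  K 0 /\ forall (x : 'rV[R]_n) (t : R), K x -> 0 <= t <= 1 -> K (t *: x).

Definition star_body K :=
  [/\ compact K, star_shaped K,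
      forall u, unit_sphere u -> 0 < radial K u
    & {within @unit_sphere R n, continuous (radial K)}].

Definition dilates K L :=
  exists c : R, forall u, unit_sphere u -> radial K u / radial L u = c.

Definition volume K : R := fine (lebesgue_rV K).

Definition dual_mixed_volume (K : 'I_n -> set 'rV[R]_n) : R :=
  n%:R^-1 * sphere_integral (fun u => \prod_(i < n) radial (K i) u).

Definition is_orlicz_sum phi K L M :=
  star_body M /\
  forall u, unit_sphere u ->
    phi (radial K u / radial M u) + phi (radial L u / radial M u) = phi 1.

Definition orlicz_sum phi K L : set 'rV[R]_n :=
  xget set0 [set M | is_orlicz_sum phi K L M].

End StarBodies.

(* Only the values of phi on (0, oo) matter. *)
Definition class_C (R : realType) (phi : R -> R) :=
  [/\ convex_function (`]0, +oo[%classic : set R^o) phi,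
      {in `]0, +oo[ &, {homo phi : x y /~ x <= y}},
      (forall t, 0 < t -> 0 < phi t),
      phi t @[t --> 0^'+] --> +oo
    & phi t @[t --> +oo] --> (0 : R)].

Definition strictly_convex_function (R : realType) (D : set R) (f : R -> R) :=
  forall x y t : R, D x -> D y -> x != y -> 0 < t < 1 ->
    f (t * x + (1 - t) * y) < t * f x + (1 - t) * f y.

(* Main.v *)
(* A tangent line of a convex function turns Jensen's inequality into a statement about integrals
   of linear expressions. With M the Orlicz sum of K_1 and L_1 and Q the product of the radial
   functions of K_2, ..., K_n, integrate the defining relation
     phi (rho_{K_1} / rho_M) + phi (rho_{L_1} / rho_M) = phi 1
   against rho_M Q and bound phi from below by its tangents at
     m_1 = V~(K_1, K_2, ..., K_n) / W   and   m_2 = V~(L_1, K_2, ..., K_n) / W,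
   where W = V~(M, K_2, ..., K_n): the linear terms cancel and phi m_1 + phi m_2 <= phi 1 remains.
   The dual Minkowski inequality V~(K_1, ..., K_n)^n <= V(K_1) ... V(K_n), which is the integral of
   the pointwise AM-GM inequality for rho_{K_i} / V(K_i)^(1/n), and the monotonicity of phi
   conclude. All integrands are continuous, so in each of the two inequalities equality holds only
   if the nonnegative integrand vanishes identically. *)
From HB Require Import structures.
Require Import Defs.
From mathcomp Require Import all_boot all_order all_algebra.
From mathcomp Require Import all_classical all_reals all_analysis.
From mathcomp Require Import measurable_realfun ring lra.
Import Order.TTheory GRing.Theory Num.Theory.
Import numFieldNormedType.Exports.

Set Implicit Arguments.
Unset Strict Implicit.
Unset Printing Implicit Defensive.

Local Open Scope classical_set_scope.
Local Open Scope ring_scope.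

(** * Lebesgue measure on row vectors *)

(** [lebesgue_rV] and [sphere_measure] are plain set functions and have to be recognised as
    measures. Since [volume] is an iterated integral, the formula n V(K) = integral of rho_K^n is a
    result about cones, obtained by slicing the sphere. [orlicz_sum] is picked by [xget], so its
    defining relation is available only once a star body satisfying it has been produced; the
    delicate point there is the continuity of its radial function. [class_C] gives weak
    monotonicity; strict decrease, which carries equality of values of phi back to the arguments,
    comes from convexity together with positivity and the limit 0 at infinity. In the converse of
    the equality case, homogeneity of the defining relation makes M a dilate of K_1, so the ratios
    rho_{K_1} / rho_M and rho_{L_1} / rho_M are constant and the relation in a single direction is
    the asserted equality. *)

Section SigmaFiniteMeasure.
Context d (T : measurableType d) (R : realType).
Variables (mu : {measure set T -> \bar R}) (mu_sf : sigma_finite setT mu).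

Let nu : set T -> \bar R := mu.
HB.instance Definition _ := Measure.on nu.
HB.instance Definition _ := Measure_isSigmaFinite.Build _ _ _ nu mu_sf.

(** The existential form hands the bundled structure, built on a section-local copy of [mu], to the
    induction on the dimension. *)
Lemma sigma_finite_measure_of :
  exists nu : {sigma_finite_measure set T -> \bar R}, forall A, nu A = mu A.
Proof. by exists nu. Qed.

End SigmaFiniteMeasure.

Section BorelRowVectors.
Context {R : realType}.

Lemma open_measurable_rV n (A : set (borel_rV R n)) :
  open (A : set 'rV[R]_n) -> measurable A.
Proof. exact: sub_sigma_algebra. Qed.

Lemma closed_measurable_rV n (A : set (borel_rV R n)) :
  closed (A : set 'rV[R]_n) -> measurable A.
Proof.
move=> cA; rewrite -[A]setCK; apply: measurableC; apply: open_measurable_rV.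
exact: (@closed_openC 'rV[R]_n).
Qed.

Lemma within_continuous_measurable_rV n (D : set 'rV[R]_n) (f : 'rV[R]_n -> R) :
  measurable (D : set (borel_rV R n)) -> {within D, continuous f} ->
  measurable_fun (D : set (borel_rV R n)) (f : borel_rV R n -> measurableTypeR R).
Proof.
move=> mD /continuousP cf; apply: (measurability _ (RGenOpens.measurableE R)).
move=> _ [_ [a [b ->] <-]].
have oab : open (`]a, b[%classic : set R) by exact: interval_open.
have /open_subspaceP[V oV] := cf _ oab.
move=> VD; have -> : D `&` f @^-1` `]a, b[ = V `&` D by rewrite VD setIC.
by apply: measurableI => //; exact: open_measurable_rV.
Qed.

Lemma open_rV_bigcup n (U : set 'rV[R]_n) : open U ->
  U = \bigcup_(p in [set p : 'rV[rat]_n * nat |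
        [set v : 'rV[R]_n | forall i, `|v 0 i - ratr (p.1 0 i)| < p.2.+1%:R^-1]
          `<=` U])
      [set v | forall i, `|v 0 i - ratr (p.1 0 i)| < p.2.+1%:R^-1].
Proof.
move=> oU; apply/seteqP; split=> [v Uv|v [p pU]]; last exact: pU.
have /nbhs_ballP[e /= e0 eU] := open_nbhs_nbhs (conj oU Uv).
(* Both v and any other point of the cube lie within 1/(k+1) of its centre, hence the factor 2. *)
have [k ke] : exists k : nat, k.+1%:R^-1 * 2 < e.
  exists (Num.truncn (2 / e)).
  have := truncnS_gt (2 / e).
  by rewrite ltr_pdivrMr// => h; rewrite ltr_pdivrMl.
have qP i : exists q : rat, `|v 0 i - ratr q| < k.+1%:R^-1.
  have /rat_in_itvoo[q] : v 0 i - k.+1%:R^-1 < v 0 i + k.+1%:R^-1.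
    by rewrite ltrD2l gt0_cp// invr_gt0.
  by rewrite in_itv/= => /andP[q1 q2]; exists q; rewrite ltr_distlC q1 q2.
pose q i := projT1 (cid (qP i)).
have qE i : `|v 0 i - ratr (q i)| < k.+1%:R^-1 := projT2 (cid (qP i)).
exists (\row_i q i, k) => /=; last by move=> i; rewrite mxE.
move=> w wP; apply: eU; split => // i j.
rewrite (ord1 i) /ball/= (lt_trans _ ke)// mulr_natr mulr2n.
have := wP j; rewrite mxE => wj.
rewrite -[v 0 j - w 0 j](subrKA (ratr (q j))) (le_lt_trans (ler_normD _ _))//.
by rewrite ltrD// distrC.
Qed.

Lemma measurable_forall d (T : measurableType d) (I : finType) (P : I -> set T) :
  (forall i, measurable (P i)) -> measurable [set x | forall i, P i x].
Proof.
move=> mP; rewrite (_ : [set _ | _] = \bigcap_(i in setT) P i).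
  exact: fin_bigcap_measurable.
by apply/seteqP; split=> x /= Px i; [move=> _; exact: Px|exact: Px].
Qed.

(** Every open set is a countable union of rational cubes, and the preimage of a cube is a finite
    intersection of preimages under the coordinates. *)
Lemma measurable_fun_rV d (T : measurableType d) n (f : T -> borel_rV R n) :
  (forall i, measurable_fun setT
     (fun x => (f x : 'rV[R]_n) 0 i : measurableTypeR R)) ->
  measurable_fun setT f.
Proof.
move=> mf; apply: (@measurability _ _ _ (borel_rV R n) setT f (@open 'rV[R]_n) erefl).
move=> _ [U /= oU <-]; rewrite setTI (open_rV_bigcup oU) preimage_bigcup.
set P := [set _ | _].
(* Cubes not contained in U are replaced by the empty set, so that the union runs over a whole
   countable type. *)
rewrite (_ : \bigcup_(p in _) _ = \bigcup_(p : 'rV[rat]_n * nat) (if `[<P p>] then f @^-1`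
   [set v | forall i, `|v 0 i - ratr (p.1 0 i)| < p.2.+1%:R^-1] else set0)); last first.
  apply/seteqP; split=> [x [p Pp xp]|x [p _]].
    by exists p => //; rewrite asboolT.
  by case: ifPn => // /asboolP Pp xp; exists p.
apply: (countable_bigcupT_measurable (countableP _)) => p; case: ifPn => // _.
rewrite (_ : _ @^-1` _ = [set x | forall i,
  ((fun x => (f x : 'rV[R]_n) 0 i : measurableTypeR R) @^-1`
    (ball (ratr (p.1 0 i) : R) p.2.+1%:R^-1 : set R)) x]); last first.
  by apply/seteqP; split=> x /= + i; move=> /(_ i); rewrite /= /ball/= distrC.
apply: measurable_forall => i; rewrite -[X in measurable X]setTI; apply: mf => //.
by rewrite ball_itv; exact: measurable_itv.
Qed.

Lemma continuous_measurable_rV n (f : 'rV[R]_n -> R) : continuous f ->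
  measurable_fun setT (f : borel_rV R n -> measurableTypeR R).
Proof.
move=> cf; apply: within_continuous_measurable_rV => //.
exact: continuous_subspaceT.
Qed.

Lemma measurable_coord_rV n (i : 'I_n) :
  measurable_fun setT (fun v : borel_rV R n => (v : 'rV[R]_n) 0 i : measurableTypeR R).
Proof. by apply: continuous_measurable_rV => x; exact: coord_continuous. Qed.

(* Pushing forward the product measure along this map gives [lebesgue_rV] in dimension [m.+1]. *)
Definition consr_rV m (p : measurableTypeR R * borel_rV R m) : borel_rV R m.+1 :=
  row_mx (p.1 : R)%:M p.2.

Lemma measurable_consr_rV m : measurable_fun setT (@consr_rV m).
Proof.
apply: measurable_fun_rV => i.
rewrite (_ : (fun p => _) = match @fintype.split 1 m i with inl _ => fst
  | inr k => (fun v : borel_rV R m => (v : 'rV[R]_m) 0 k : measurableTypeR R) \o snd end).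
  case: fintype.split => [_|k]; first exact: measurable_fst.
  by apply: measurableT_comp; [exact: measurable_coord_rV|exact: measurable_snd].
apply/funext => p; rewrite /consr_rV mxE; case: fintype.split => // j.
by rewrite (ord1 j) mxE eqxx mulr1n.
Qed.

Lemma lebesgue_rV_set0 n : @lebesgue_rV R n set0 = 0%E.
Proof.
elim: n => [|n IH] /=; first by rewrite indic0.
rewrite (_ : (fun x => _) = cst 0%E); first exact: integral0.
by apply/funext => x; rewrite -[RHS]IH.
Qed.

(** Cubes are the test sets: they exhaust the space, bound the unit ball from outside and fit inside
    cones over open patches. *)
Lemma lebesgue_rV_box n (c : 'rV[R]_n) (e : R) : 0 < e ->
  lebesgue_rV [set v : 'rV[R]_n | forall i, `|v 0 i - c 0 i| <= e] =
  ((2 * e) ^+ n)%:E.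
Proof.
move=> e0; elim: n c => [|n IH] c.
  by rewrite /= indicE mem_set// => -[].
rewrite /=; pose a := c 0 0; pose B : set (measurableTypeR R) := `[a - e, a + e]%classic.
have BE (x : R) : (x \in B) = (`|x - a| <= e).
  by apply/idP/idP; rewrite /B inE/= in_itv/= ler_distl.
rewrite (_ : (fun x : measurableTypeR R => _) = (cst ((2 * e) ^+ n)%:E) \_ B).
  rewrite -integral_mkcond integral_cst; last exact: measurable_itv.
  rewrite [X in (_ * X)%E](_ : _ = (2 * e)%:E).
    by rewrite -EFinM exprSr.
  transitivity (lebesgue_measure B) => //.
  rewrite /B lebesgue_measure_itv/= lte_fin ltrD2l gt0_cp// -EFinD; congr _%:E; ring.
apply/funext => x; rewrite patchE BE; case: ifPn => xa; last first.
  rewrite -[RHS](@lebesgue_rV_set0 n); congr (lebesgue_rV _).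
  apply/seteqP; split=> v //= /(_ (@lshift 1 n 0)).
  have E0 : @lshift 1 n 0 = 0 :> 'I_n.+1 by apply: val_inj.
  by rewrite (@row_mxEl _ 1 1 n) mxE eqxx mulr1n E0 -/a (negbTE xa).
rewrite -(IH (@rsubmx _ 1 1 n c)); congr (lebesgue_rV _).
apply/seteqP; split=> v /= + i.
  by move=> /(_ (@rshift 1 n i)); rewrite (@row_mxEr _ 1 1 n) mxE.
move=> vP; rewrite mxE; case: splitP => j ij.
  rewrite (ord1 j) mxE eqxx mulr1n (_ : i = 0)//; apply/val_inj => /=.
  by rewrite [LHS]ij (ord1 j).
have := vP j; rewrite mxE (_ : rshift 1 j = i :> 'I_(1 + n))//; apply: val_inj; exact: esym ij.
Qed.

Lemma measurable_box n (c : 'rV[R]_n) (e : R) :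
  measurable ([set v | forall i, `|v 0 i - c 0 i| <= e] : set (borel_rV R n)).
Proof.
rewrite [X in measurable X](_ : _ = [set v | forall i,
  ((fun v : borel_rV R n => (v : 'rV[R]_n) 0 i : measurableTypeR R) @^-1`
   `[c 0 i - e, c 0 i + e]%classic) v]); last first.
  by apply/seteqP; split=> v /= vP i; have := vP i; rewrite ler_distl in_itv.
apply: measurable_forall => i; rewrite -[X in measurable X]setTI.
by apply: measurable_coord_rV => //; exact: measurable_itv.
Qed.

(** Sigma-finiteness is carried through the induction because the product with the measure of the
    slices relies on it. *)
Lemma lebesgue_rV_measure n :
  exists mu : {sigma_finite_measure set (borel_rV R n) -> \bar R},
    forall A, mu A = lebesgue_rV A.
Proof.
elim: n => [|n [mu muE]].
  by exists (dirac (0 : borel_rV R 0)) .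
have [M ME] : exists M : {measure set (borel_rV R n.+1) -> \bar R},
    forall A, M A = lebesgue_rV A.
  exists (measure_function_pushforward__canonical__measure_function_Measure
    (lebesgue_measure \x mu)%E (@measurable_consr_rV n)) => A.
  rewrite /= /pushforward /product_measure1; apply: eq_integral => x _ /=.
  rewrite muE; congr lebesgue_rV.
  by apply/seteqP; split=> v /=; rewrite /xsection/= inE.
have Msf : sigma_finite setT M.
  exists (fun k => [set v : 'rV[R]_n.+1 | forall i, `|v 0 i - (0 : 'rV[R]_n.+1) 0 i| <= k.+1%:R]).
    apply/seteqP; split=> // v _.
    exists (Num.truncn `|v|) => // i; rewrite mxE subr0.
    have /ltW := truncnS_gt `|v|; apply: le_trans.
    by rewrite [leRHS]/Num.Def.normr/= mx_normrE; apply/bigmax_geP; right => /=; exists (0, i).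
  move=> k; split; last by rewrite ME lebesgue_rV_box// ltry.
  exact: measurable_box.
have [nu nuE] := sigma_finite_measure_of Msf.
by exists nu => A; rewrite nuE ME.
Qed.


(** The bundled form agrees with [lebesgue_rV] on all sets, so rewriting between them creates no
    measurability condition. *)
Definition leb n : {sigma_finite_measure set (borel_rV R n) -> \bar R} :=
  projT1 (cid (lebesgue_rV_measure n)).

Lemma lebE n (A : set (borel_rV R n)) : leb n A = lebesgue_rV A.
Proof. by rewrite /leb; case: cid. Qed.

(** The pushforward under x -> a x, multiplied by a, has the right value on half-open intervals;
    uniqueness of Lebesgue measure does the rest. *)
Lemma lebesgue_measure_scale (a : R) (A : set (measurableTypeR R)) :
  0 < a -> measurable A ->
  lebesgue_measure ((fun x : measurableTypeR R => a * x : measurableTypeR R) @^-1` A) =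
  (a^-1%:E * lebesgue_measure A)%E.
Proof.
move=> a0 mA.
have ma : measurable_fun setT (fun x : measurableTypeR R => a * x : measurableTypeR R).
  by apply: measurable_funM => //; exact: measurable_cst.
pose P := measure_function_pushforward__canonical__measure_function_Measure
    (@lebesgue_measure R) ma.
pose Q := mscale (NngNum (ltW a0)) P.
have <- : Q A = lebesgue_measure A.
  apply/esym/lebesgue_measure_unique => // _ [[x y]] _ <-.
  rewrite -[RHS]/(a%:E * lebesgue_measure ((fun z : R => (a * z)%R) @^-1` `]x, y]))%E.
  have -> : (fun z : R => a * z) @^-1` `]x, y] = `]x / a, y / a]%classic.
    by apply/seteqP; split=> z /=; rewrite !in_itv/= ltr_pdivrMr// ler_pdivlMr// mulrC.
  rewrite !lebesgue_measure_itv/= !lte_fin ltr_pM2r ?invr_gt0//.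
  case: ifPn => xy; last by rewrite mule0.
  by rewrite -!EFinD -EFinM -mulrBl mulrCA mulfV ?gt_eqF// mulr1.
by rewrite /Q /mscale /= muleA -EFinM mulVf ?gt_eqF// mul1e.
Qed.

Lemma ge0_integral_scale (a : R) (g : R -> \bar R) : 0 < a ->
  measurable_fun setT (g : measurableTypeR R -> \bar R) -> (forall x, 0 <= g x)%E ->
  (\int[lebesgue_measure]_x g (a * x)%R = a^-1%:E * \int[lebesgue_measure]_x g x)%E.
Proof.
move=> a0 mg g0.
have ma : measurable_fun setT (fun x : measurableTypeR R => a * x : measurableTypeR R).
  by apply: measurable_funM => //; exact: measurable_cst.
have a'0 : 0 <= a^-1 by rewrite invr_ge0 ltW.
have := @ge0_integral_pushforward _ _ _ _ R _ ma lebesgue_measure setT g measurableT mg.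
rewrite preimage_setT => /= <-; last by move=> x _; exact: g0.
rewrite (eq_measure_integral (mscale (NngNum a'0) lebesgue_measure)).
  by rewrite ge0_integral_mscale.
by move=> A mA _; rewrite [LHS]lebesgue_measure_scale.
Qed.

(** The slice at x of the preimage of A is the preimage of the slice of A at a x; each outer
    integral contributes one factor a^-1 by change of variable. *)
Lemma lebesgue_rV_scale n (a : R) (A : set (borel_rV R n)) : 0 < a -> measurable A ->
  lebesgue_rV [set v : 'rV[R]_n | A (a *: v)] = ((a^-1 ^+ n)%:E * lebesgue_rV A)%E.
Proof.
move=> a0; elim: n A => [|n IH] A mA.
  rewrite /= expr0 mul1e; congr ((\1_ _ _)%:E).
  by apply/seteqP; split=> v /=; rewrite (_ : a *: v = v)//; apply/rowP => -[].
have mA' : measurable (@consr_rV n @^-1` A).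
  by rewrite -[X in measurable X]setTI; exact: measurable_consr_rV.
pose G (x : R) := lebesgue_rV [set v : 'rV[R]_n | A (row_mx (x : R)%:M v)].
have GE x : G x = (leb n \o xsection (@consr_rV n @^-1` A)) x.
  by rewrite /= lebE; congr lebesgue_rV; apply/seteqP; split=> v /=; rewrite /xsection/= inE.
have mG : measurable_fun setT (G : measurableTypeR R -> \bar R).
  by rewrite (funext GE); exact: measurable_fun_xsection.
have G0 x : (0 <= G x)%E by rewrite GE.
have mGa : measurable_fun setT (fun x : measurableTypeR R => G (a * x)).
  apply: (measurableT_comp mG).
  by apply: measurable_funM => //; exact: measurable_cst.
rewrite /= -[X in (_ * X)%E]/(\int[lebesgue_measure]_x G x)%E.
rewrite exprSr EFinM -muleA -ge0_integral_scale// -ge0_integralZl//; last first.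
  by rewrite lee_fin exprn_ge0// invr_ge0 ltW.
apply: eq_integral => x _; rewrite -IH.
  by congr lebesgue_rV; apply/seteqP; split=> v /=; rewrite (@scale_row_mx _ 1 1 n) scale_scalar_mx.
have := measurable_xsection (a * x : measurableTypeR R) mA'.
by congr measurable; apply/seteqP; split=> v /=; rewrite /xsection/= inE.
Qed.

End BorelRowVectors.

(** * The sphere and its measure *)

Section FiniteMeasure.
Context d (T : measurableType d) (R : realType).
Variables (mu : {measure set T -> \bar R}) (mu_fin : fin_num_fun mu).

Let nu : set T -> \bar R := mu.
HB.instance Definition _ := Measure.on nu.
HB.instance Definition _ := Measure_isFinite.Build _ _ _ nu mu_fin.

Lemma finite_measure_of :
  exists nu : {finite_measure set T -> \bar R}, forall A, nu A = mu A.
Proof. by exists nu. Qed.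

End FiniteMeasure.

Section Sphere.
Context {R : realType} {n : nat}.
Implicit Types (u v : 'rV[R]_n) (A : set 'rV[R]_n).
Local Notation S := (@unit_sphere R n).

Lemma enorm_ge0 v : 0 <= enorm v.
Proof. exact: sqrtr_ge0. Qed.

Lemma enormZ a v : enorm (a *: v) = `|a| * enorm v.
Proof.
rewrite /enorm -sqrtr_sqr -sqrtrM ?sqr_ge0// mulr_sumr; congr Num.sqrt.
by apply: eq_bigr => i _; rewrite mxE exprMn.
Qed.

Lemma coord_le_enorm v i : `|v 0 i| <= enorm v.
Proof.
rewrite -sqrtr_sqr; apply: ler_wsqrtr; rewrite (bigD1 i)//= lerDl.
by apply: sumr_ge0 => j _; exact: sqr_ge0.
Qed.

Lemma norm_le_enorm v : `|v| <= enorm v.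
Proof.
rewrite [leLHS]/Num.Def.normr/= mx_normrE; apply/bigmax_leP; split.
  exact: enorm_ge0.
by move=> [i j] _ /=; rewrite (ord1 i); exact: coord_le_enorm.
Qed.

Lemma enorm_eq0 v : (enorm v == 0) = (v == 0).
Proof.
apply/eqP/eqP => [v0|->].
  by apply/eqP; rewrite -normr_le0 -v0 norm_le_enorm.
by rewrite -[0 in LHS](scale0r 0) enormZ normr0 mul0r.
Qed.

Lemma enorm_gt0 v : (0 < enorm v) = (v != 0).
Proof. by rewrite lt_def enorm_ge0 andbT enorm_eq0. Qed.

Lemma continuous_enorm : continuous (@enorm R n).
Proof.
move=> v; apply: (@continuous_comp _ _ _ (fun v : 'rV[R]_n => \sum_i v 0 i ^+ 2)); last first.
  exact: sqrt_continuous.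
have FF : Filter (nbhs v) by exact: nbhs_filter.
apply: (@cvg_big _ _ +%R 0 xpredT _ _ (nbhs v) _ _ _ FF) => [|i _]; first exact: add_continuous.
apply: (@continuous_comp _ _ _ (fun v : 'rV[R]_n => v 0 i) (fun x : R => x ^+ 2) v).
  exact: coord_continuous.
exact: exprn_continuous.
Qed.

(** Since 0^-1 = 0, the origin is sent to itself, off the sphere. *)
Definition sproj v : 'rV[R]_n := (enorm v)^-1 *: v.

Lemma unit_sphere_sproj v : v != 0 -> S (sproj v).
Proof.
move=> v0; rewrite /unit_sphere/= /sproj enormZ ger0_norm ?invr_ge0 ?enorm_ge0//.
by rewrite mulVf// enorm_eq0.
Qed.

Lemma sproj_scale r u : 0 < r -> S u -> sproj (r *: u) = u.
Proof.
move=> r0 Su; rewrite /sproj enormZ Su mulr1 gtr0_norm// scalerA mulVf ?gt_eqF//.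
by rewrite scale1r.
Qed.

Lemma scale_sproj v : enorm v *: sproj v = v.
Proof.
have [->|v0] := eqVneq v 0; first by rewrite /sproj !scaler0.
by rewrite /sproj scalerA mulfV ?enorm_eq0// scale1r.
Qed.

Lemma sprojZ r v : 0 < r -> sproj (r *: v) = sproj v.
Proof.
move=> r0; rewrite /sproj enormZ gtr0_norm// scalerA invfM mulrAC.
by rewrite mulVf ?gt_eqF// mul1r.
Qed.

Lemma continuous_sproj v : v != 0 -> {for v, continuous sproj}.
Proof.
move=> v0.
have FF : Filter (nbhs v) by exact: nbhs_filter.
have c1 : (enorm w)^-1 @[w --> nbhs v] --> (enorm v)^-1.
  apply: (@continuous_comp _ _ _ (@enorm R n) (fun x => x^-1)).
    exact: continuous_enorm.
  by apply: inv_continuous; rewrite enorm_eq0.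
exact: (cvgZ c1 (@cvg_id _ (nbhs v))).
Qed.

Lemma measurable_enorm :
  measurable_fun setT (@enorm R n : borel_rV R n -> measurableTypeR R).
Proof. by apply: continuous_measurable_rV; exact: continuous_enorm. Qed.

Lemma measurable_sproj : measurable_fun setT (sproj : borel_rV R n -> borel_rV R n).
Proof.
apply: measurable_fun_rV => i.
(* The real power with exponent -1 is measurable and agrees with the inverse on nonnegative reals,
   with common value 0 at 0. *)
rewrite (_ : (fun x => _) = (fun v : borel_rV R n => powR (enorm v) (-1) * (v : 'rV[R]_n) 0 i)).
  apply: measurable_funM; last exact: measurable_coord_rV.
  apply: (@measurableT_comp _ _ _ _ _ _ (@powR R ^~ (-1)) _
    (@enorm R n : borel_rV R n -> measurableTypeR R)); last exact: measurable_enorm.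
  exact: measurable_powR.
by apply/funext => v; rewrite mxE powR_inv1// enorm_ge0.
Qed.

Lemma compact_sphere : compact S.
Proof.
apply: bounded_closed_compact.
  exists 1; split => // x x1 v Sv.
  by apply: (le_trans (norm_le_enorm v)); rewrite Sv ltW.
have -> : S = @enorm R n @^-1` [set 1] by [].
apply: closed_comp; last exact: closed_eq.
by move=> v _; exact: continuous_enorm.
Qed.

Lemma measurable_sphere : measurable (S : set (borel_rV R n)).
Proof.
apply: closed_measurable_rV; apply: compact_closed; last exact: compact_sphere.
exact: norm_hausdorff.
Qed.

Definition punctured_ball : set (borel_rV R n) := [set v | 0 < enorm v <= 1].

Lemma measurable_punctured_ball : measurable punctured_ball.
Proof.
rewrite (_ : punctured_ball = @enorm R n @^-1` `]0, 1]%classic).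
  by rewrite -[X in measurable X]setTI; apply: measurable_enorm => //; exact: measurable_itv.
by apply/seteqP; split=> v /=; rewrite /punctured_ball/= in_itv.
Qed.

(** In this form the cone is a preimage, which exhibits [sphere_measure] as n times the pushforward
    along [sproj] of Lebesgue measure restricted to the punctured ball. *)
Lemma unit_coneE A : unit_cone A = punctured_ball `&` sproj @^-1` A.
Proof.
apply/seteqP; split=> [_ [r [u [/andP[r0 r1] Su Au ->]]]|v [/andP[v0 v1] Av]].
  by rewrite /punctured_ball/= enormZ Su mulr1 gtr0_norm// sproj_scale// r0 r1.
exists (enorm v), (sproj v); split => //; first by rewrite v0.
  by apply: unit_sphere_sproj; rewrite -enorm_gt0.
by rewrite scale_sproj.
Qed.

Lemma measurable_unit_cone (A : set (borel_rV R n)) :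
  measurable A -> measurable (unit_cone A : set (borel_rV R n)).
Proof.
move=> mA; rewrite unit_coneE; apply: measurableI.
  exact: measurable_punctured_ball.
by rewrite -[X in measurable X]setTI; exact: measurable_sproj.
Qed.

Lemma punctured_ball_lty : (leb n punctured_ball < +oo)%E.
Proof.
apply: (@le_lt_trans _ _ (leb n
    [set v : 'rV[R]_n | forall i, `|v 0 i - (0 : 'rV[R]_n) 0 i| <= 1])).
  apply: le_measure; rewrite ?inE; first exact: measurable_punctured_ball.
    exact: measurable_box.
  by move=> v /andP[_ v1] i /=; rewrite mxE subr0 (le_trans (coord_le_enorm v i)).
by rewrite lebE lebesgue_rV_box// ltry.
Qed.

Lemma sphere_measure_measure :
  exists mu : {finite_measure set (borel_rV R n) -> \bar R},
    forall A, mu A = sphere_measure A.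
Proof.
pose P := measure_function_pushforward__canonical__measure_function_Measure
  (mrestr (leb n) measurable_punctured_ball) measurable_sproj.
pose Q := mscale (NngNum (ler0n R n)) P.
have QE A : Q A = sphere_measure A.
  by rewrite /sphere_measure unit_coneE setIC -lebE.
have Qfin : fin_num_fun Q.
  move=> A mA; rewrite QE /sphere_measure -lebE ge0_fin_numE ?mule_ge0//.
  rewrite lte_mul_pinfty//; apply: le_lt_trans punctured_ball_lty.
  apply: le_measure; rewrite ?inE; [exact: measurable_unit_cone|exact: measurable_punctured_ball|].
  by rewrite unit_coneE; exact: subIsetl.
by have [nu nuE] := finite_measure_of Qfin; exists nu => A; exact: etrans (nuE A) (QE A).
Qed.

(** * Algebra of functions continuous on a subset *)

Lemma within_continuousP (T : topologicalType) (A : set 'rV[R]_n) (f : 'rV[R]_n -> T) :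
  {within A, continuous f} <-> forall u, A u -> f @ within A (nbhs u) --> f u.
Proof. exact: subspace_continuousP. Qed.

Lemma within_continuousD (A : set 'rV[R]_n) (f g : 'rV[R]_n -> R) :
  {within A, continuous f} -> {within A, continuous g} ->
  {within A, continuous (fun u => f u + g u)}.
Proof.
move=> /within_continuousP cf /within_continuousP cg; apply/within_continuousP => u Au.
by apply: cvgD; [exact: cf|exact: cg].
Qed.

Lemma within_continuousN (A : set 'rV[R]_n) (f : 'rV[R]_n -> R) :
  {within A, continuous f} -> {within A, continuous (fun u => - f u)}.
Proof.
move=> /within_continuousP cf; apply/within_continuousP => u Au.
by apply: cvgN; exact: cf.
Qed.

Lemma within_continuousM (A : set 'rV[R]_n) (f g : 'rV[R]_n -> R) :
  {within A, continuous f} -> {within A, continuous g} ->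
  {within A, continuous (fun u => f u * g u)}.
Proof.
move=> /within_continuousP cf /within_continuousP cg; apply/within_continuousP => u Au.
by apply: cvgM; [exact: cf|exact: cg].
Qed.

Lemma within_continuous_cst (A : set 'rV[R]_n) (c : R) :
  {within A, continuous (fun _ => c)}.
Proof. by apply/within_continuousP => u Au; exact: cvg_cst. Qed.

Lemma within_continuous_prod (A : set 'rV[R]_n) (I : Type) (r : seq I) (P : pred I)
    (f : I -> 'rV[R]_n -> R) :
  (forall i, P i -> {within A, continuous (f i)}) ->
  {within A, continuous (fun u => \prod_(i <- r | P i) f i u)}.
Proof.
move=> cf; apply/within_continuousP => u Au.
have FF : Filter (within A (nbhs u)) by exact: within_filter.
apply: (@cvg_big _ _ (@GRing.mul R) (1 : R) P _ _ (within A (nbhs u)) _ _ _ FF).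
  exact: mul_continuous.
move=> i Pi.
by move/within_continuousP: (cf i Pi); exact.
Qed.

Lemma within_continuous_sum (A : set 'rV[R]_n) (I : Type) (r : seq I) (P : pred I)
    (f : I -> 'rV[R]_n -> R) :
  (forall i, P i -> {within A, continuous (f i)}) ->
  {within A, continuous (fun u => \sum_(i <- r | P i) f i u)}.
Proof.
move=> cf; apply/within_continuousP => u Au.
have FF : Filter (within A (nbhs u)) by exact: within_filter.
apply: (@cvg_big _ _ +%R 0 P _ _ (within A (nbhs u)) _ _ _ FF).
  exact: add_continuous.
move=> i Pi.
by move/within_continuousP: (cf i Pi); exact.
Qed.

Lemma within_continuousX (A : set 'rV[R]_n) (f : 'rV[R]_n -> R) k :
  {within A, continuous f} -> {within A, continuous (fun u => f u ^+ k)}.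
Proof.
move=> cf; elim: k => [|k IH]; first exact: within_continuous_cst.
rewrite (_ : (fun u => f u ^+ k.+1) = (fun u => f u * f u ^+ k)).
  exact: within_continuousM.
by apply/funext => u; rewrite exprS.
Qed.

(** * Integration of continuous functions over the sphere *)

Definition sph : {finite_measure set (borel_rV R n) -> \bar R} :=
  projT1 (cid sphere_measure_measure).

Lemma sphE (A : set (borel_rV R n)) : sph A = sphere_measure A.
Proof. by rewrite /sph; case: cid. Qed.

Lemma sphere_integralE (f : 'rV[R]_n -> R) :
  sphere_integral f = \int[sph]_(u in S) f u.
Proof. by rewrite /sphere_integral /Rintegral -(funext sphE). Qed.

Lemma integrable_sphere (f : 'rV[R]_n -> R) : {within S, continuous f} ->
  sph.-integrable S (EFin \o (f : borel_rV R n -> R)).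
Proof.
move=> cf; apply: measurable_bounded_integrable.
- exact: measurable_sphere.
- by rewrite -ge0_fin_numE//; exact: (fin_num_measure sph _ measurable_sphere).
- by apply: within_continuous_measurable_rV => //; exact: measurable_sphere.
- have /compact_bounded[M [Mr MP]] := continuous_compact cf compact_sphere.
  by exists M; split => // x Mx u Su; apply: (MP x Mx); exists u.
Qed.

Lemma eq_sphere_integral (f g : 'rV[R]_n -> R) :
  (forall u, S u -> f u = g u) -> sphere_integral f = sphere_integral g.
Proof.
move=> fg; rewrite !sphere_integralE; apply: eq_Rintegral => u; rewrite inE => Su.
exact: fg.
Qed.

Lemma sphere_integralD (f g : 'rV[R]_n -> R) :
  {within S, continuous f} -> {within S, continuous g} ->
  sphere_integral (fun u => f u + g u) = sphere_integral f + sphere_integral g.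
Proof.
move=> cf cg; rewrite !sphere_integralE RintegralD//.
- exact: measurable_sphere.
- exact: integrable_sphere.
- exact: integrable_sphere.
Qed.

Lemma sphere_integralZ (c : R) (f : 'rV[R]_n -> R) :
  {within S, continuous f} ->
  sphere_integral (fun u => c * f u) = c * sphere_integral f.
Proof.
move=> cf; rewrite !sphere_integralE RintegralZl//.
- exact: measurable_sphere.
- exact: integrable_sphere.
Qed.

Lemma sphere_integral_sum (I : Type) (r : seq I) (f : I -> 'rV[R]_n -> R) :
  (forall i, {within S, continuous (f i)}) ->
  sphere_integral (fun u => \sum_(i <- r) f i u) = \sum_(i <- r) sphere_integral (f i).
Proof.
move=> cf; elim: r => [|i r IH].
  rewrite big_nil (@eq_sphere_integral _ (cst 0)); last by move=> u _; rewrite big_nil.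
  by rewrite sphere_integralE /Rintegral integral0.
rewrite big_cons -IH -sphere_integralD//; last exact: within_continuous_sum.
by apply: eq_sphere_integral => u _; rewrite big_cons.
Qed.

Lemma sphere_integral_ge0 (f : 'rV[R]_n -> R) :
  (forall u, S u -> 0 <= f u) -> 0 <= sphere_integral f.
Proof. by move=> f0; rewrite sphere_integralE; exact: Rintegral_ge0. Qed.

(** The point u/2 is interior to the cone over the patch, so the cone contains a cube of positive
    volume. *)
Lemma sphere_measure_open_gt0 (U : set 'rV[R]_n) u :
  (0 < n)%N -> open U -> S u -> U u -> (0 < sph (S `&` U))%E.
Proof.
move=> n0 oU Su Uu; rewrite sphE /sphere_measure mule_gt0//.
  by rewrite lte_fin ltr0n.
have mSU : measurable (S `&` U : set (borel_rV R n)).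
  by apply: measurableI; [exact: measurable_sphere|exact: open_measurable_rV].
pose v0 : 'rV[R]_n := 2^-1 *: u.
have ev0 : enorm v0 = 2^-1 by rewrite enormZ Su mulr1 gtr0_norm// invr_gt0.
have v00 : v0 != 0 by rewrite -enorm_gt0 ev0 invr_gt0.
have pv0 : sproj v0 = u by rewrite sproj_scale// invr_gt0.
have FF : Filter (nbhs v0) by exact: nbhs_filter.
have n1 : \forall v \near nbhs v0, U (sproj v).
  by apply: (continuous_sproj v00); apply: open_nbhs_nbhs; split; rewrite ?pv0.
have n2 : \forall v \near nbhs v0, (`]0, 1[%classic : set R) (enorm v).
  move: (@continuous_enorm v0) => /(_ (`]0, 1[%classic : set R)); apply.
  apply: open_nbhs_nbhs; split.
    exact: interval_open.
  by rewrite ev0 /= in_itv/= invr_gt0 ltr0n/= invf_lt1// ltr1n.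
have n12 : nbhs v0 [set v | U (sproj v) /\ (`]0, 1[%classic : set R) (enorm v)].
  exact: filterI.
have /nbhs_ballP[e /= e0 eP] := n12.
(* The cube is closed and the ball open, so the half-side is taken strictly below e. *)
have e2 : 0 < e / 2 by rewrite divr_gt0.
apply: (@lt_le_trans _ _ (((2 * (e / 2)) ^+ n)%:E)).
  by rewrite lte_fin exprn_gt0// mulr_gt0.
rewrite -(lebesgue_rV_box v0 e2) -!lebE; apply: le_measure; rewrite ?inE.
- exact: measurable_box.
- exact: measurable_unit_cone.
move=> v vP; have [] : (U (sproj v) /\ (`]0, 1[%classic : set R) (enorm v)).
  apply: eP; split => // i j; rewrite (ord1 i) /ball/= distrC.
  apply: le_lt_trans (vP j) _.
  by rewrite ltr_pdivrMr// ltr_pMr// ltr1n.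
rewrite /= in_itv/= => Upv /andP[v1 v2]; rewrite unit_coneE; split.
  by rewrite /punctured_ball/= v1 ltW.
by split => //=; apply: unit_sphere_sproj; rewrite -enorm_gt0.
Qed.

(** By continuity f exceeds f(u)/2 on a relatively open patch around u, and such a patch has
    positive measure. *)
Lemma sphere_integral_gt0 (f : 'rV[R]_n -> R) u : (0 < n)%N ->
  {within S, continuous f} -> (forall v, S v -> 0 <= f v) -> S u -> 0 < f u ->
  0 < sphere_integral f.
Proof.
move=> n0 cf f0 Su fu.
pose c := f u / 2; have c0 : 0 < c by rewrite divr_gt0.
have /continuousP/(_ _ (@open_gt R c))/open_subspaceP[V oV VE] := cf.
have VS v : S v -> V v <-> c < f v.
  move=> Sv; have : (V `&` S) v <-> (f @^-1` [set y | c < y] `&` S) v by rewrite VE.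
  by rewrite /=; tauto.
have Vu : V u by apply/VS => //; rewrite /c ltr_pdivrMr// ltr_pMr// ltr1n.
have mV : measurable (S `&` V : set (borel_rV R n)).
  by apply: measurableI; [exact: measurable_sphere|exact: open_measurable_rV].
have : (0 < c%:E * sph (S `&` V))%E.
  by rewrite mule_gt0// (sphere_measure_open_gt0 n0 oV Su Vu).
have cV : (c%:E * sph (S `&` V) <= \int[sph]_(u in S) (f u)%:E)%E.
  have mf : measurable_fun (S : set (borel_rV R n)) (EFin \o (f : borel_rV R n -> R)).
    by have /integrableP[] := integrable_sphere cf.
  rewrite -integral_cst//; apply: (@le_trans _ _ (\int[sph]_(u in S `&` V) (f u)%:E)%E).
    apply: ge0_le_integral => //.
    - by move=> v _; rewrite lee_fin ltW.
    - by apply: measurable_funS mf; [exact: measurable_sphere|exact: subIsetl].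
    - by move=> v [Sv Vv]; rewrite lee_fin ltW//; apply/VS.
  apply: ge0_subset_integral => //; first exact: measurable_sphere.
move=> /lt_le_trans/(_ cV) h; rewrite sphere_integralE; apply: fine_gt0; rewrite h/=.
rewrite -ge0_fin_numE; last exact: ltW.
by apply: integrable_fin_num; [exact: measurable_sphere|exact: integrable_sphere].
Qed.

End Sphere.

(** * Volume in polar coordinates *)

Section Polar.
Context {R : realType} {n : nat}.
Implicit Types (u v : 'rV[R]_n) (A K : set 'rV[R]_n).
Local Notation S := (@unit_sphere R n).

Lemma unit_sphere_neq0 u : S u -> u != 0.
Proof. by move=> Su; rewrite -enorm_gt0 Su. Qed.

(** Compactness turns the supremum into a maximum: the admissible multiples are bounded since u is
    nonzero, and K is closed. Star-shapedness fills in all smaller multiples. *)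
Lemma radialP K u c : star_body K -> S u -> 0 <= c -> K (c *: u) <-> c <= radial K u.
Proof.
move=> [cK [K0 Kst] _ _] Su c0.
have u0 : 0 < `|u| by rewrite normr_gt0 unit_sphere_neq0.
pose T := [set c | 0 <= c /\ K (c *: u)].
have supT : has_sup T.
  split; first by exists 0; split => //; rewrite scale0r.
  have [M [_ MK]] := compact_bounded cK.
  exists ((`|M| + 1) / `|u|) => d [d0 Kd]; rewrite ler_pdivlMr//.
  rewrite -{1}(ger0_norm d0) -normrZ; apply: (MK _ _ _ Kd).
  by rewrite (le_lt_trans (ler_norm M))// ltrDl.
split=> [Kc|cr].
  by apply: ub_le_sup; [exact: supT.2|split].
have Ks : K (radial K u *: u).
  apply: contrapT => nK.
  have /= : \forall d \near nbhs (radial K u), ~ K (d *: u).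
    have h : (fun d : R => d *: u) @ nbhs (radial K u) --> radial K u *: u.
      by apply: cvgZr_tmp; exact: cvg_id.
    apply: (h (~` K)); apply: open_nbhs_nbhs; split => //.
    by apply: closed_openC; apply: compact_closed cK; exact: norm_hausdorff.
  move=> /nbhs_ballP[e /= e0 eP].
  have [d [d0 Kd] dlt] := sup_adherent e0 supT.
  apply: (eP d) => //; rewrite /ball/= ger0_norm ?subr_ge0 ?ltrBlDr 1?addrC -?ltrBlDr//.
  by apply: ub_le_sup; [exact: supT.2|split].
have [r0|r0] := leP (radial K u) 0.
  by rewrite (_ : c = 0) ?scale0r//; apply/eqP; rewrite eq_le c0 (le_trans cr).
have -> : c *: u = (c / radial K u) *: (radial K u *: u).
  by rewrite scalerA divfK// gt_eqF.
by apply: Kst => //; rewrite divr_ge0 ?(ltW r0)//= ler_pdivrMr// mul1r.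
Qed.

Lemma star_bodyE K v : star_body K -> v != 0 ->
  K v <-> enorm v <= radial K (sproj v).
Proof.
move=> sK v0; rewrite -{1}(scale_sproj v); apply: radialP => //.
  exact: unit_sphere_sproj.
exact: enorm_ge0.
Qed.

Lemma measurable_origin : measurable ([set 0] : set (borel_rV R n)).
Proof.
apply: closed_measurable_rV; apply: compact_closed; last exact: compact_set1.
exact: norm_hausdorff.
Qed.

Lemma measurable_neq0 : measurable ([set v | v != 0] : set (borel_rV R n)).
Proof.
rewrite (_ : [set _ | _] = ~` [set 0 : 'rV[R]_n]).
  by apply: measurableC; exact: measurable_origin.
by apply/seteqP; split=> v /= /eqP.
Qed.

Lemma measurable_cone A (r : R) : measurable (A : set (borel_rV R n)) ->
  measurable ([set v | v != 0 /\ A (sproj v) /\ enorm v <= r] : set (borel_rV R n)).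
Proof.
move=> mA.
rewrite (_ : [set _ | _] = [set v | v != 0] `&` ((sproj : borel_rV R n -> borel_rV R n) @^-1` A
   `&` (@enorm R n : borel_rV R n -> measurableTypeR R) @^-1` `]-oo, r]%classic)).
  apply: measurableI; first exact: measurable_neq0.
  apply: measurableI; rewrite -[X in measurable X]setTI.
    exact: measurable_sproj.
  by apply: measurable_enorm => //; exact: measurable_itv.
by apply/seteqP; split=> v /=; rewrite in_itv.
Qed.

(** The cone truncated at radius r is r times the unit cone, whose volume defines the spherical
    measure. *)
Lemma leb_cone_scale A (r : R) : 0 < r -> measurable (A : set (borel_rV R n)) ->
  (n%:R%:E * leb n [set v : 'rV[R]_n | (v != 0)%R /\ A (sproj v) /\ (enorm v <= r)%R] =
   (r ^+ n)%:E * sph A)%E.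
Proof.
move=> r0 mA; rewrite sphE /sphere_measure muleCA; congr (_ * _)%E.
rewrite lebE -[r in RHS]invrK -(@lebesgue_rV_scale _ _ r^-1); last 2 first.
- by rewrite invr_gt0.
- exact: measurable_unit_cone.
congr lebesgue_rV; apply/seteqP; split=> v; rewrite unit_coneE /punctured_ball /=.
  move=> [v0 [Av vr]]; rewrite sprojZ ?invr_gt0// enormZ gtr0_norm ?invr_gt0//.
  by rewrite mulr_gt0 ?invr_gt0 ?enorm_gt0//= mulrC ler_pdivrMr// mul1r.
rewrite sprojZ ?invr_gt0// enormZ gtr0_norm ?invr_gt0// mulrC ler_pdivrMr// mul1r.
move=> [/andP[v0 vr] Av]; split => //; rewrite -enorm_gt0.
by move: v0; rewrite pmulr_lgt0// invr_gt0.
Qed.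

(** The singleton is invariant under doubling, so its finite measure m satisfies m = 2^-n m. *)
Lemma leb_origin : (0 < n)%N -> leb n [set 0 : 'rV[R]_n] = 0%E.
Proof.
move=> n0; have m0 := measurable_origin.
have h := lebesgue_rV_scale (ltr0n R 2) m0.
have E : [set v : 'rV[R]_n | [set 0] (2 *: v)] = [set 0].
  apply/seteqP; split=> v /=; last by move=> ->; rewrite scaler0.
  by move=> /eqP; rewrite scaler_eq0 pnatr_eq0/= => /eqP.
move: h; rewrite E -!lebE => h.
have fin : leb n [set 0 : 'rV[R]_n] \is a fin_num.
  rewrite ge0_fin_numE//.
  apply: (@le_lt_trans _ _ (leb n
    [set v : 'rV[R]_n | forall i, `|v 0 i - (0 : 'rV[R]_n) 0 i| <= 1])).
    apply: le_measure; rewrite ?inE//; first exact: measurable_box.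
    by move=> v -> i; rewrite subrr normr0.
  by rewrite lebE lebesgue_rV_box// ltry.
move: h; rewrite -(fineK fin) -EFinM => -[] /eqP.
rewrite -subr_eq0 -[X in X - _]mul1r -mulrBl mulf_eq0 => /orP[|/eqP ->//].
rewrite subr_eq0 => /eqP h; have : (2^-1 : R) ^+ n < 1.
  by rewrite exprn_ilt1// ?invr_ge0// ?invf_lt1 ?ltr1n// -lt0n.
by rewrite -h ltxx.
Qed.

(* The sphere is cut into the slices [A k] on which [g] varies by at most [d]; over each slice the
   truncated cone bounded by [g] lies between two scaled cones over [A k], so the volume and the
   integral differ by at most [d * sph S]. *)
Variable g : borel_rV R n -> R.
Hypothesis mg : measurable_fun setT g.
Hypothesis g0 : forall u, 0 <= g u.
Hypothesis n0 : (0 < n)%N.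

Let G := [set v : 'rV[R]_n | v != 0 /\ enorm v ^+ n <= g (sproj v)].

Let mG : measurable (G : set (borel_rV R n)).
Proof.
have -> : G = [set v | v != 0] `&`
    (fun v : borel_rV R n => g (sproj v) - enorm v ^+ n) @^-1` `[0, +oo[%classic.
  by apply/seteqP; split=> v; rewrite /G/= in_itv/= andbT subr_ge0.
apply: measurableI; first exact: measurable_neq0.
rewrite -[X in measurable X]setTI.
have mh : measurable_fun setT (fun v : borel_rV R n => g (sproj v) - enorm v ^+ n).
  apply: measurable_funB; first by apply: (measurableT_comp mg); exact: measurable_sproj.
  by apply: measurable_funX; exact: measurable_enorm.
by apply: mh => //; exact: measurable_itv.
Qed.

Variable d : R.
Hypothesis d0 : 0 < d.

Let A k : set (borel_rV R n) := S `&` g @^-1` `[k%:R * d, k.+1%:R * d[%classic.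

Let mA k : measurable (A k).
Proof.
apply: measurableI; first exact: measurable_sphere.
by rewrite -[X in measurable X]setTI; apply: mg => //; exact: measurable_itv.
Qed.

Let AE k u : A k u <-> S u /\ Num.truncn (g u / d) = k.
Proof.
have gd : 0 <= g u / d by rewrite divr_ge0// ltW.
rewrite /A /= in_itv/= -ler_pdivlMr// -ltr_pdivrMr//; split=> -[Su].
  by move=> /andP[h1 h2]; split => //; apply/eqP; rewrite truncn_eq// h1.
by move=> /eqP; rewrite truncn_eq.
Qed.

Let tA : trivIset setT A.
Proof.
apply/trivIsetP => i j _ _ ij; apply/seteqP; split=> u // [/AE[_ ui] /AE[_ uj]].
by move: ij; rewrite -ui -uj eqxx.
Qed.

Let AS : \bigcup_k A k = S.
Proof.
apply/seteqP; split=> [u [k _ /AE[]//]|u Su].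
by exists (Num.truncn (g u / d)) => //; exact/AE.
Qed.

Let B k : set (borel_rV R n) := G `&` sproj @^-1` A k.

Let mB k : measurable (B k).
Proof.
apply: measurableI => //; rewrite -[X in measurable X]setTI.
by apply: measurable_sproj.
Qed.

Let sumB : (leb n G = \sum_(k <oo) leb n (B k))%E.
Proof.
rewrite -measure_semi_bigcup//; last 2 first.
- apply/trivIsetP => i j _ _ ij; apply/seteqP; split=> u // [[_ ui] [_ uj]].
  have A0 : A i `&` A j = set0 by move/trivIsetP: tA => /(_ i j Logic.I Logic.I ij).
  have : (A i `&` A j) (sproj u) by split.
  by rewrite A0.
- exact: bigcupT_measurable.
congr (leb n _); rewrite /B -setI_bigcupr -preimage_bigcup AS.
by apply/seteqP; split=> [v Gv|v []//]; split => //; apply: unit_sphere_sproj; case: Gv.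
Qed.

Let sum_int : (\int[sph]_(u in S) (g u)%:E = \sum_(k <oo) \int[sph]_(u in A k) (g u)%:E)%E.
Proof.
rewrite -[in LHS]AS ge0_integral_bigcup//.
- by apply/measurable_EFinP; apply: measurable_funTS.
- by move=> u _; rewrite lee_fin.
Qed.

Let root r : 0 < r -> exists2 s : R, 0 < s & s ^+ n = r.
Proof.
move=> r0; exists (r `^ n%:R^-1); first exact: powR_gt0.
by rewrite -powR_mulrn ?powR_ge0// -powRrM mulVf ?pnatr_eq0 -?lt0n// powRr1// ltW.
Qed.

Let B_le k : (n%:R%:E * leb n (B k) <= (k.+1%:R * d)%:E * sph (A k))%E.
Proof.
have [s s0 sE] := root (mulr_gt0 (ltr0Sn R k) d0).
rewrite -sE -leb_cone_scale//; apply: lee_wpmul2l => //; apply: le_measure; rewrite ?inE//.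
  exact: measurable_cone.
move=> v [[v0 vg] Av]; split => //; split => //.
rewrite -(ler_pXn2r n0) ?nnegrE ?enorm_ge0 ?(ltW s0)// sE (le_trans vg)//.
by move: Av; rewrite /A /= in_itv/= => -[_ /andP[_ /ltW]].
Qed.

Let B_ge k : ((k%:R * d)%:E * sph (A k) <= n%:R%:E * leb n (B k))%E.
Proof.
(* On the lowest slice the lower bound is 0, and there is no cone of positive radius to compare
   with. *)
case: k => [|k]; first by rewrite mul0r mul0e mule_ge0.
have [s s0 sE] := root (mulr_gt0 (ltr0Sn R k) d0).
rewrite -sE -leb_cone_scale//; apply: lee_wpmul2l => //; apply: le_measure; rewrite ?inE//.
  exact: measurable_cone.
move=> v [v0 [Av vs]]; split => //; split => //.
apply: (@le_trans _ _ (s ^+ n)); first by rewrite ler_pXn2r// nnegrE ?enorm_ge0 ?(ltW s0).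
by rewrite sE; move: Av; rewrite /A /= in_itv/= => -[_ /andP[]].
Qed.

Let int_le k : (\int[sph]_(u in A k) (g u)%:E <= (k.+1%:R * d)%:E * sph (A k))%E.
Proof.
rewrite -integral_cst//; apply: ge0_le_integral => //.
- by move=> u _; rewrite lee_fin.
- by apply/measurable_EFinP; apply: measurable_funTS.
- by move=> u; rewrite /A /= in_itv/= lee_fin => -[_ /andP[_ /ltW]].
Qed.

Let int_ge k : ((k%:R * d)%:E * sph (A k) <= \int[sph]_(u in A k) (g u)%:E)%E.
Proof.
rewrite -integral_cst//; apply: ge0_le_integral => //.
- by move=> u _; rewrite lee_fin mulr_ge0 ?(ltW d0).
- by apply/measurable_EFinP; apply: measurable_funTS.
- by move=> u; rewrite /A /= in_itv/= lee_fin => -[_ /andP[]].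
Qed.

Let split_slice k : ((k.+1%:R * d)%:E * sph (A k) =
  (k%:R * d)%:E * sph (A k) + d%:E * sph (A k))%E.
Proof.
rewrite -ge0_muleDl ?lee_fin ?mulr_ge0 ?(ltW d0)//.
by rewrite -EFinD -[d in (_ + d)%R]mul1r -mulrDl -natr1.
Qed.

Let sum_sph : (\sum_(k <oo) (d%:E * sph (A k)) = d%:E * sph S)%E.
Proof.
rewrite nneseriesZl//; congr (_ * _)%E.
by rewrite -measure_semi_bigcup ?AS//; exact: measurable_sphere.
Qed.

Let polar_le : (n%:R%:E * leb n G <= \int[sph]_(u in S) (g u)%:E + d%:E * sph S)%E.
Proof.
rewrite sumB sum_int -sum_sph -nneseriesZl// -nneseriesD//.
- apply: lee_nneseries => k _ //=; first by rewrite mule_ge0.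
  apply: le_trans (B_le k) _.
  by rewrite split_slice; apply: leeD.
- by move=> k _ _; apply: integral_ge0 => u _; rewrite lee_fin.
- by move=> k _ _; rewrite mule_ge0// lee_fin ltW.
Qed.

Let polar_ge : (\int[sph]_(u in S) (g u)%:E <= n%:R%:E * leb n G + d%:E * sph S)%E.
Proof.
rewrite sumB sum_int -sum_sph -nneseriesZl// -nneseriesD//.
- apply: lee_nneseries => k _ //.
    by move=> _; apply: integral_ge0 => u _; rewrite lee_fin.
  apply: le_trans (int_le k) _.
  by rewrite split_slice; apply: leeD.
- by move=> k _ _; rewrite mule_ge0.
- by move=> k _ _; rewrite mule_ge0// lee_fin ltW.
Qed.

(** Two additive bounds rather than a bound on a difference: for a general measurable g both
    quantities may be infinite. *)
Lemma polar_approx :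
  (n%:R%:E * leb n G <= \int[sph]_(u in S) (g u)%:E + d%:E * sph S)%E /\
  (\int[sph]_(u in S) (g u)%:E <= n%:R%:E * leb n G + d%:E * sph S)%E.
Proof. by split; [exact: polar_le|exact: polar_ge]. Qed.

End Polar.

Section VolumePolar.
Context {R : realType} {n : nat}.
Implicit Types (K : set 'rV[R]_n).
Local Notation S := (@unit_sphere R n).

Lemma lee_approx (x y t : \bar R) : (0 <= t)%E -> t \is a fin_num ->
  (forall d : R, (0 < d)%R -> x <= y + d%:E * t)%E -> (x <= y)%E.
Proof.
move=> t0 tfin h; apply/lee_addgt0Pr => e e0.
(* The summand 1 keeps the denominator of the chosen d positive when t = 0. *)
have t1 : 0 < fine t + 1 by rewrite ltr_wpDl// fine_ge0.
apply: le_trans (h (e / (fine t + 1)) _) _; first by rewrite divr_gt0.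
apply: leeD => //; rewrite -{2}(fineK tfin) -EFinM lee_fin mulrAC.
by rewrite ler_pdivrMr// ler_pM2l// lerDl.
Qed.

(** Up to the null set formed by the origin, K is the region |v|^n <= rho_K(v/|v|)^n, to which the
    slicing estimate applies with every mesh d > 0. *)
Lemma volume_polar K : (0 < n)%N -> star_body K ->
  sphere_integral (fun u => radial K u ^+ n) = n%:R * volume K.
Proof.
move=> n0 sK; have [cK _ rpos crad] := sK.
have cf := within_continuousX (k := n) crad.
(* Extension by zero off the sphere makes the integrand measurable and nonnegative everywhere. *)
pose g : borel_rV R n -> R := (fun u => radial K u ^+ n) \_ S.
have gE u : S u -> g u = radial K u ^+ n by move=> Su; rewrite /g patchE mem_set.
have mg : measurable_fun setT g.
  apply/(measurable_restrictT _ measurable_sphere).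
  by apply: within_continuous_measurable_rV => //; exact: measurable_sphere.
have g0 u : 0 <= g u.
  rewrite /g patchE; case: ifPn => // /set_mem Su.
  by rewrite exprn_ge0// ltW// rpos.
set G := [set v : 'rV[R]_n | v != 0 /\ enorm v ^+ n <= g (sproj v)].
have GE v : G v <-> K v /\ v != 0.
  have [->|v0] := eqVneq v 0; first by split=> -[]; rewrite /G/= eqxx.
  rewrite /G /= v0 gE; last exact: unit_sphere_sproj.
  rewrite (star_bodyE sK v0) ler_pXn2r ?nnegrE ?enorm_ge0//; first tauto.
  by rewrite ltW// rpos//; exact: unit_sphere_sproj.
have mK : measurable (K : set (borel_rV R n)).
  by apply: closed_measurable_rV; apply: compact_closed cK; exact: norm_hausdorff.
have m0 : measurable ([set 0] : set (borel_rV R n)) by exact: measurable_origin.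
have GK : G = K `\` [set 0].
  by apply/seteqP; split=> v; [move=> /GE[Kv /eqP]|move=> [Kv /= /eqP ?]; exact/GE].
have KG : leb n K = leb n G.
  rewrite GK -[in LHS](setDUK (_ : [set 0] `<=` K)); last by move=> _ ->; case: sK => _ [].
  rewrite measureU//; first by rewrite [X in (X + _)%E](leb_origin n0) add0e.
    exact: measurableD.
  by apply/seteqP; split=> v // [] /= -> [].
have Sfin : sph (S : set (borel_rV R n)) \is a fin_num.
  exact: (fin_num_measure sph _ measurable_sphere).
have XY : (n%:R%:E * leb n G = \int[sph]_(u in S) (g u)%:E)%E.
  apply/eqP; rewrite eq_le; apply/andP.
  split; apply: (@lee_approx _ _ (sph (S : set (borel_rV R n)))) => // d d0.
    by have [] := polar_approx mg g0 n0 d0.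
  by have [] := polar_approx mg g0 n0 d0.
rewrite (@eq_sphere_integral _ _ _ g); last by move=> u Su; rewrite gE.
rewrite sphere_integralE /Rintegral -XY /volume -lebE KG.
(* In the infinite cases [fine] returns 0 on both sides. *)
case: (leb n G) => [r| |] //=.
  by rewrite mulry gtr0_sg ?ltr0n// mul1e/= mulr0.
by rewrite mulrNy gtr0_sg ?ltr0n// mul1e/= mulr0.
Qed.

End VolumePolar.

(** * The Orlicz harmonic radial sum *)

Section ClassC.
Context {R : realType} (phi : R -> R).
Hypothesis phi_C : class_C phi.

Lemma class_C_gt0 t : 0 < t -> 0 < phi t.
Proof. by case: phi_C => _ _ h _ _; exact: h. Qed.

Lemma class_C_le x y : 0 < x -> x <= y -> phi y <= phi x.
Proof.
move=> x0 xy; case: phi_C => _ h _ _ _; apply: h => //.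
  by rewrite in_itv/= andbT (lt_le_trans x0).
by rewrite in_itv/= andbT.
Qed.

Lemma class_C_convex x y t : 0 < x -> 0 < y -> 0 <= t <= 1 ->
  phi (t * x + (1 - t) * y) <= t * phi x + (1 - t) * phi y.
Proof.
move=> x0 y0 /andP[t0 t1]; case: phi_C => h _ _ _ _.
have := h (Itv01 t0 t1) x y; rewrite !inE/= !in_itv/= !andbT => /(_ x0 y0).
by rewrite !convRE.
Qed.

Lemma class_C_small e : 0 < e -> exists2 T, 0 < T & phi T < e.
Proof.
move=> e0; case: phi_C => _ _ _ _ h.
have : \forall t \near +oo, `|0 - phi t| < e by move: e e0; apply/cvgrPdist_lt.
move=> [M [Mr MP]]; exists (Num.max M 0 + 1).
  by rewrite ltr_wpDl// le_max lexx orbT.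
have := MP (Num.max M 0 + 1); rewrite sub0r normrN gtr0_norm.
  by apply; rewrite (le_lt_trans (_ : M <= Num.max M 0)) ?le_max ?lexx// ltrDl.
by apply: class_C_gt0; rewrite ltr_wpDl// le_max lexx orbT.
Qed.

(** If phi took the same value at x and y, a point T further out with phi T below that value would
    place the graph at y above the chord from x to T. *)
Lemma class_C_lt x y : 0 < x -> x < y -> phi y < phi x.
Proof.
move=> x0 xy; have y0 := lt_trans x0 xy.
rewrite lt_neqAle (class_C_le x0 (ltW xy)) andbT; apply/eqP => yx.
have [T T0 Ty] := class_C_small (class_C_gt0 y0).
have [Tly|yT] := leP T y.
  by have := class_C_le T0 Tly; rewrite leNgt Ty.
have xT : 0 < T - x by rewrite subr_gt0 (lt_trans xy).
pose t := (T - y) / (T - x).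
have t0 : 0 <= t by rewrite divr_ge0// subr_ge0 ltW// (lt_trans xy).
have t1 : t < 1 by rewrite ltr_pdivrMr// mul1r ltrD2l ltrN2.
have /(class_C_convex x0 T0) : 0 <= t <= 1 by rewrite t0 ltW.
have -> : t * x + (1 - t) * T = y by rewrite /t; field; rewrite gt_eqF.
rewrite yx; have : 0 < 1 - t by rewrite subr_gt0.
nra.
Qed.

Lemma class_C_slope a m b : 0 < a -> a < m -> m < b ->
  (phi m - phi a) / (m - a) <= (phi b - phi m) / (b - m).
Proof.
move=> a0 am mb.
have ba : 0 < b - a by rewrite subr_gt0 (lt_trans am).
have b0 : 0 < b by rewrite (lt_trans a0)// (lt_trans am).
pose t := (b - m) / (b - a).
have t0 : 0 <= t by rewrite divr_ge0// subr_ge0 ltW// (lt_trans am).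
have t1 : t <= 1 by rewrite ler_pdivrMr// mul1r lerD2l lerN2 ltW.
have /(class_C_convex a0 b0) : 0 <= t <= 1 by rewrite t0.
have -> : t * a + (1 - t) * b = m by rewrite /t; field; rewrite gt_eqF.
have -> : t * phi a + (1 - t) * phi b = ((b - m) * phi a + (m - a) * phi b) / (b - a).
  by rewrite /t; field; rewrite gt_eqF.
rewrite ler_pdivlMr// ler_pdivrMr ?subr_gt0// mulrAC ler_pdivlMr ?subr_gt0//.
by nra.
Qed.

(** The slope is the supremum of the chord slopes to the left of m, each of which is at most every
    chord slope to the right. *)
Lemma class_C_tangent m : 0 < m -> exists s,
  forall x, 0 < x -> phi m + s * (x - m) <= phi x.
Proof.
move=> m0.
pose T := [set s | exists2 a, 0 < a < m & s = (phi m - phi a) / (m - a)].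
have T0 : T !=set0.
  exists ((phi m - phi (m / 2)) / (m - m / 2)), (m / 2) => //.
  by rewrite divr_gt0// ltr_pdivrMr// ltr_pMr// ltr1n.
have ubT b : m < b -> ubound T ((phi b - phi m) / (b - m)).
  by move=> mb _ [a /andP[a0 am] ->]; exact: class_C_slope.
have supT : has_sup T by split=> //; eexists; apply: (ubT (m + 1)); rewrite ltrDl.
exists (sup T) => x x0; have [xm|mx|->] := ltgtP x m; last by rewrite subrr mulr0 addr0.
  have : (phi m - phi x) / (m - x) <= sup T.
    by apply: ub_le_sup; [exact: supT.2|exists x => //; rewrite x0].
  by rewrite ler_pdivrMr ?subr_gt0//; lra.
have : sup T <= (phi x - phi m) / (x - m) by apply: ge_sup => //; exact: ubT.
by rewrite ler_pdivlMr ?subr_gt0//; lra.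
Qed.

(** Contact at x would contradict strict convexity at the midpoint of x and m, where the graph still
    lies above the tangent. *)
Lemma class_C_tangent_lt m s : 0 < m ->
  (forall x, 0 < x -> phi m + s * (x - m) <= phi x) ->
  strictly_convex_function `]0, +oo[ phi ->
  forall x, 0 < x -> x != m -> phi m + s * (x - m) < phi x.
Proof.
move=> m0 sP sc x x0 xm.
have /(sc x m) : 0 < (2^-1 : R) < 1 by rewrite invr_gt0 ltr0n invf_lt1// ltr1n.
rewrite /= !in_itv/= !andbT => /(_ x0 m0 xm).
have y0 : 0 < 2^-1 * x + (1 - 2^-1) * m by lra.
have := sP _ y0; lra.
Qed.

(** Testing the tangent at x against the point c/2, at distance at least c/2 from x, bounds its
    steepness by phi(c/2) / (c/2). *)
Lemma class_C_lipschitz c x y : 0 < c -> c <= x -> x <= y ->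
  phi x - phi y <= phi (c / 2) / (c / 2) * (y - x).
Proof.
move=> c0 cx xy; have x0 := lt_le_trans c0 cx; have y0 := lt_le_trans x0 xy.
have [s sP] := class_C_tangent x0.
have h1 := sP _ y0; have c2 : 0 < c / 2 by rewrite divr_gt0.
have h2 := sP _ c2; have p := class_C_gt0 x0; have pc := class_C_gt0 c2.
have hs : - s <= phi (c / 2) / (c / 2).
  by rewrite ler_pdivlMr//; have [s0|s0] := leP 0 s; nra.
have : - s * (y - x) <= phi (c / 2) / (c / 2) * (y - x).
  by apply: ler_wpM2r => //; rewrite subr_ge0.
lra.
Qed.

Lemma class_C_continuous x : 0 < x -> {for x, continuous phi}.
Proof.
move=> x0; apply/cvgrPdist_le => e e0.
have c0 : 0 < x / 2 by rewrite divr_gt0.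
have c20 : 0 < x / 2 / 2 by rewrite divr_gt0.
pose C := phi (x / 2 / 2) / (x / 2 / 2).
have C0 : 0 < C by rewrite divr_gt0// class_C_gt0.
near=> y.
have xy : `|x - y| <= e / C.
  by near: y; apply/nbhs_ballP; exists (e / C) => [|z /ltW]//=; rewrite divr_gt0.
have xc : `|x - y| <= x / 2.
  by near: y; apply/nbhs_ballP; exists (x / 2) => [|z /ltW]//=; rewrite divr_gt0.
have yc : x / 2 <= y by move: xc; rewrite ler_norml; lra.
have xc' : x / 2 <= x by lra.
move: xy; rewrite ler_pdivlMr// => /(le_trans _); apply.
have [yx|yx] := leP y x.
  have := class_C_lipschitz c0 yc yx; rewrite -/C.
  rewrite ler0_norm ?subr_le0 ?class_C_le// ?(lt_le_trans c0)// ger0_norm ?subr_ge0//; lra.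
have := class_C_lipschitz c0 xc' (ltW yx); rewrite -/C.
have p : phi y <= phi x by apply: class_C_le => //; exact: ltW.
have xy' : x - y <= 0 by rewrite subr_le0 ltW.
by rewrite ger0_norm ?subr_ge0// ler0_norm//; lra.
Unshelve. all: by end_near. Qed.

(** Intermediate value theorem in the variable s = 1/r: at s = 1/a the first term alone is already
    phi 1. *)
Lemma orlicz_root a b : 0 < a -> 0 < b ->
  exists2 r, 0 < r & phi (a / r) + phi (b / r) = phi 1.
Proof.
move=> a0 b0.
have [T T0 TP] := class_C_small (divr_gt0 (class_C_gt0 ltr01) (ltr0n R 2)).
(* At [s1] both arguments are at least T, so each term is below phi(1)/2; the entry [a^-1] orients
   the interval. *)
pose s1 := Num.max (T / a) (Num.max (T / b) a^-1).
have s1a : a^-1 <= s1 by rewrite !le_max lexx !orbT.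
have s10 : 0 < s1 by rewrite (lt_le_trans _ s1a)// invr_gt0.
pose H s := phi (a * s) + phi (b * s).
have cH : {within `[a^-1, s1], continuous H}.
  apply: continuous_in_subspaceT => s; rewrite inE/= in_itv/= => /andP[as_ _].
  have s0 : 0 < s by rewrite (lt_le_trans _ as_)// invr_gt0.
  apply: cvgD.
    apply: (@continuous_comp _ _ _ (fun s => a * s) phi); first exact: mulrl_continuous.
    by apply: class_C_continuous; rewrite mulr_gt0.
  apply: (@continuous_comp _ _ _ (fun s => b * s) phi); first exact: mulrl_continuous.
  by apply: class_C_continuous; rewrite mulr_gt0.
have Ha : phi 1 <= H a^-1.
  by rewrite /H mulfV ?gt_eqF// lerDl ltW// class_C_gt0// divr_gt0.
have Hs : H s1 <= phi 1.
  have h1 : phi (a * s1) <= phi T.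
    by apply: class_C_le => //; rewrite mulrC -ler_pdivrMr// !le_max lexx.
  have h2 : phi (b * s1) <= phi T.
    by apply: class_C_le => //; rewrite mulrC -ler_pdivrMr// !le_max lexx orbT.
  by rewrite /H; lra.
have [] := @IVT R H _ _ (phi 1) s1a cH.
  by rewrite ge_min Hs orbT le_max Ha.
move=> s; rewrite in_itv/= => /andP[as_ _] Hse; exists s^-1.
  by rewrite invr_gt0 (lt_le_trans _ as_)// invr_gt0.
by rewrite !invrK.
Qed.

(* The root is monotone and homogeneous in [(a, b)], which yields its continuity. *)
Lemma orlicz_root_le a b r a' b' r' l : 0 < a -> 0 < b -> 0 < r -> 0 < a' -> 0 < b' -> 0 < r' ->
  0 < l -> phi (a / r) + phi (b / r) = phi 1 -> phi (a' / r') + phi (b' / r') = phi 1 ->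
  a' <= l * a -> b' <= l * b -> r' <= l * r.
Proof.
move=> a0 b0 r0 a'0 b'0 r'0 l0 e1 e2 la lb; rewrite leNgt; apply/negP => lr.
have ha : phi (a / r) < phi (a' / r').
  apply: class_C_lt; first by rewrite divr_gt0.
  by rewrite ltr_pdivrMr// mulrAC ltr_pdivlMr//; nra.
have hb : phi (b / r) < phi (b' / r').
  apply: class_C_lt; first by rewrite divr_gt0.
  by rewrite ltr_pdivrMr// mulrAC ltr_pdivlMr//; nra.
by have := ltrD ha hb; rewrite e1 e2 ltxx.
Qed.

End ClassC.

(** * Star bodies with prescribed radial function *)

Section StarBodyOfRadial.
Context {R : realType} {n : nat}.
Local Notation S := (@unit_sphere R n).

Lemma star_body_of_radial (r : 'rV[R]_n -> R) :
  (forall u, S u -> 0 < r u) -> {within S, continuous r} ->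
  exists M, star_body M /\ forall u, S u -> radial M u = r u.
Proof.
(* The origin is adjoined by hand because r is uncontrolled at [sproj 0], which is not on the
   sphere. *)
move=> r0 cr; pose M := [set v | v = 0 \/ enorm v <= r (sproj v)].
have MP u c : S u -> 0 <= c -> M (c *: u) <-> c <= r u.
  move=> Su; rewrite le_eqVlt => /predU1P[<-|c0].
    by rewrite scale0r; split; [move=> _; exact/ltW/r0|left].
  rewrite /M /= enormZ Su mulr1 gtr0_norm// sproj_scale//; split; last by right.
  move=> [/eqP|//]; rewrite scaler_eq0 (gt_eqF c0)/= => /eqP u0.
  by move: (unit_sphere_neq0 Su); rewrite u0 eqxx.
have radM u : S u -> radial M u = r u.
  move=> Su; rewrite /radial.
  rewrite (_ : [set c | _] = `[0, r u]%classic) ?sup_itvcc//; first by apply: ltW; exact: r0.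
  apply/seteqP; split=> c /=; rewrite in_itv/=.
    by move=> [c0 /(MP _ _ Su c0) ->]; rewrite c0.
  by move=> /andP[c0 cr']; split => //; exact/MP.
exists M; split => //; split.
- apply: bounded_closed_compact.
    have /compact_bounded[B [Br BP]] := continuous_compact cr compact_sphere.
    exists (Num.max B 0); split => [|x]; first exact: num_real.
    rewrite gt_max => /andP[Bx x0] v [->|vr] /=; first by rewrite normr0 ltW.
    have [->|v0] := eqVneq v 0; first by rewrite normr0 ltW.
    apply: le_trans (norm_le_enorm v) _; apply: le_trans vr _.
    apply: le_trans (ler_norm _) _; apply: (BP x Bx).
    by exists (sproj v) => //; exact: unit_sphere_sproj.
  rewrite -openC openE => v nM.
  have v0 : v != 0 by apply/eqP => v0; apply: nM; left.
  have rv : r (sproj v) < enorm v.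
    by rewrite ltNge; apply/negP => h; apply: nM; right.
  (* A level strictly between the two values separates v from M, and by continuity still separates
     all nearby points. *)
  pose c := (enorm v + r (sproj v)) / 2.
  have cv : c < enorm v by rewrite /c; lra.
  have rc : r (sproj v) < c by rewrite /c; lra.
  have FF : Filter (nbhs v) by exact: nbhs_filter.
  have n1 : \forall w \near nbhs v, c < enorm w.
    exact: (cvgr_gt _ (@continuous_enorm R n v)).
  have Sv := unit_sphere_sproj v0.
  have n2 : \forall u \near nbhs (sproj v), S u -> r u < c.
    move/within_continuousP: cr => /(_ _ Sv) h.
    have FS : Filter (within S (nbhs (sproj v))) by exact: within_filter.
    exact: (cvgr_lt _ h).
  have n3 : \forall w \near nbhs v, S (sproj w) -> r (sproj w) < c.
    exact: (continuous_sproj v0 n2).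
  apply: filterS (filterI n1 n3) => w [cw rw] [w0|wr].
    have := rw; rewrite w0.
    by move: cw; rewrite w0 => /(lt_trans (lt_trans (r0 _ Sv) rc)); rewrite enorm_gt0 eqxx.
  have w0 : w != 0 by rewrite -enorm_gt0 (lt_trans _ cw)// (lt_trans (r0 _ Sv)).
  by have := lt_trans (rw (unit_sphere_sproj w0)) cw; rewrite ltNge wr.
- split; first by left.
  move=> v t [->|vr] /andP[t0 t1]; first by rewrite scaler0; left.
  move: t0; rewrite le_eqVlt => /predU1P[<-|t0]; first by rewrite scale0r; left.
  right; rewrite enormZ sprojZ// gtr0_norm//; apply: le_trans vr.
  by rewrite ler_piMl// enorm_ge0.
- by move=> u Su; rewrite radM// r0.
- apply/within_continuousP => u Su; rewrite radM//.
  move/within_continuousP: cr => /(_ u Su) h.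
  apply: cvg_trans h; apply: near_eq_cvg; near=> w; rewrite radM//.
  by near: w; exact: withinT.
Unshelve. all: by end_near. Qed.

End StarBodyOfRadial.

(** * Existence of the Orlicz sum *)

Section OrliczSum.
Context {R : realType} {n : nat}.
Local Notation S := (@unit_sphere R n).

Lemma within_sphere_near (f : 'rV[R]_n -> R) u d : {within S, continuous f} ->
  S u -> 0 < d -> \forall v \near within S (nbhs u), `|f u - f v| <= d.
Proof.
move=> /within_continuousP/(_ u) cf Su d0.
have FS : Filter (within S (nbhs u)) by exact: within_filter.
exact: (@cvgrPdist_le _ _ _ _ FS f (f u)).1 (cf Su) d d0.
Qed.

Lemma is_orlicz_sumP (phi : R -> R) (K L : set 'rV[R]_n) :
  class_C phi -> star_body K -> star_body L ->
  is_orlicz_sum phi K L (orlicz_sum phi K L).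
Proof.
move=> phi_C [_ _ K0 cK] [_ _ L0 cL]; apply: xgetPex.
have rootP u : exists r : R, 0 < r /\
    (S u -> phi (radial K u / r) + phi (radial L u / r) = phi 1).
  have [Su|nSu] := pselect (S u); last by exists 1.
  by have [r r0 rE] := orlicz_root phi_C (K0 _ Su) (L0 _ Su); exists r.
pose r u := projT1 (cid (rootP u)).
have r0 u : 0 < r u by rewrite /r; case: cid => ? [].
have rE u : S u -> phi (radial K u / r u) + phi (radial L u / r u) = phi 1.
  by rewrite /r; case: cid => ? [].
have [|M [sM rM]] := @star_body_of_radial R n r (fun u _ => r0 u); last first.
  by exists M; split => // u Su; rewrite rM// rE.
apply/within_continuousP => u Su.
have FS : Filter (within S (nbhs u)) by exact: within_filter.
apply/cvgrPdist_le => e e0.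
(* The roots at u and v will differ by a factor at most 1 + d, hence by at most d (1 + d) r(u) <= 2
   d r(u) <= e. *)
pose d := Num.min 1 (e / (2 * r u)).
have d0 : 0 < d by rewrite lt_min ltr01 divr_gt0// mulr_gt0.
have d1 : d <= 1 by rewrite ge_min lexx.
have de : d * (2 * r u) <= e by rewrite -ler_pdivlMr ?mulr_gt0// ge_min lexx orbT.
have Ku := K0 _ Su; have Lu := L0 _ Su.
near=> v.
have Sv : S v by near: v; exact: withinT.
have hK : `|radial K u - radial K v| <= d / 2 * radial K u.
  by near: v; apply: within_sphere_near => //; rewrite mulr_gt0// divr_gt0.
have hL : `|radial L u - radial L v| <= d / 2 * radial L u.
  by near: v; apply: within_sphere_near => //; rewrite mulr_gt0// divr_gt0.
have Kv := K0 _ Sv; have Lv := L0 _ Sv.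
have l0 : 0 < 1 + d by rewrite addr_gt0.
(* The tolerance d/2 gives both directions, as (1 + d)(1 - d/2) >= 1 for d <= 1. *)
have sandwich (a b : R) : 0 < a -> `|a - b| <= d / 2 * a ->
    b <= (1 + d) * a /\ a <= (1 + d) * b.
  by move=> a0; rewrite ler_norml => /andP[h1 h2]; split; nra.
have [k1 k2] := sandwich _ _ Ku hK; have [l1 l2] := sandwich _ _ Lu hL.
have r1 := orlicz_root_le phi_C Ku Lu (r0 u) Kv Lv (r0 v) l0 (rE _ Su) (rE _ Sv) k1 l1.
have r2 := orlicz_root_le phi_C Kv Lv (r0 v) Ku Lu (r0 u) l0 (rE _ Sv) (rE _ Su) k2 l2.
have ru := r0 u; have rv := r0 v.
rewrite ler_norml; apply/andP; split; nra.
Unshelve. all: by end_near. Qed.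

End OrliczSum.

(** * The dual Minkowski inequality *)

Section DualMinkowski.
Context {R : realType} {n : nat}.
Local Notation S := (@unit_sphere R n).
Hypothesis n_gt0 : (0 < n)%N.

Let n0 : (n%:R : R) != 0.
Proof. by rewrite pnatr_eq0 -lt0n. Qed.

Lemma unit_sphere_nonempty : exists u, S u.
Proof.
exists (sproj (const_mx 1)); apply: unit_sphere_sproj; apply/eqP => /rowP.
by move=> /(_ (Ordinal n_gt0)) /eqP; rewrite !mxE oner_eq0.
Qed.

Lemma sphere_integral_eq0 (f : 'rV[R]_n -> R) : {within S, continuous f} ->
  (forall u, S u -> 0 <= f u) -> sphere_integral f = 0 -> forall u, S u -> f u = 0.
Proof.
move=> cf f0 If u Su; apply/eqP; rewrite eq_le f0// andbT leNgt; apply/negP => fu.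
by have := sphere_integral_gt0 n_gt0 cf f0 Su fu; rewrite If ltxx.
Qed.

Lemma volume_gt0 (K : set 'rV[R]_n) : star_body K -> 0 < volume K.
Proof.
move=> sK; have [_ _ K0 cK] := sK; have [u Su] := unit_sphere_nonempty.
rewrite -(pmulr_rgt0 _ (_ : 0 < n%:R)) ?ltr0n// -volume_polar//.
apply: (sphere_integral_gt0 n_gt0 _ _ Su); first exact: within_continuousX.
  by move=> v Sv; rewrite exprn_ge0// ltW// K0.
by rewrite exprn_gt0// K0.
Qed.

Definition vol_radius (K : set 'rV[R]_n) : R := volume K `^ n%:R^-1.

Lemma vol_radius_gt0 K : star_body K -> 0 < vol_radius K.
Proof. by move=> /volume_gt0; exact: powR_gt0. Qed.

Lemma vol_radiusX K : star_body K -> vol_radius K ^+ n = volume K.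
Proof.
move=> /volume_gt0 V0.
by rewrite -powR_mulrn ?powR_ge0// -powRrM mulVf// powRr1// ltW.
Qed.

Lemma dilates_radial (K L : set 'rV[R]_n) : star_body K -> star_body L ->
  dilates K L <-> exists2 c, 0 < c & forall u, S u -> radial K u = c * radial L u.
Proof.
move=> [_ _ K0 _] [_ _ L0 _]; split=> [[c cP]|[c c0 cP]].
  have [u0 Su0] := unit_sphere_nonempty; exists c.
    by rewrite -(cP _ Su0) divr_gt0// ?K0 ?L0.
  by move=> u Su; rewrite -(cP u)// divfK// gt_eqF// L0.
by exists c => u Su; rewrite cP// mulfK// gt_eqF// L0.
Qed.

Lemma dilates_sym (K L : set 'rV[R]_n) : dilates K L -> dilates L K.
Proof. by move=> [c cP]; exists c^-1 => u Su; rewrite -(cP u Su) invf_div. Qed.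

Lemma vol_radius_dilate (K L : set 'rV[R]_n) c : star_body K -> star_body L -> 0 < c ->
  (forall u, S u -> radial K u = c * radial L u) -> vol_radius K = c * vol_radius L.
Proof.
move=> sK sL c0 cP; have [_ _ L0 cL] := sL.
apply: (pexpIrn n_gt0); rewrite ?nnegrE ?ltW ?mulr_gt0 ?vol_radius_gt0//.
rewrite exprMn !vol_radiusX//; apply: (mulfI n0); rewrite mulrCA -!volume_polar//.
rewrite -sphere_integralZ; last exact: within_continuousX.
by apply: eq_sphere_integral => u Su; rewrite cP// exprMn.
Qed.

Variable K : 'I_n -> set 'rV[R]_n.
Hypothesis star_K : forall i, star_body (K i).

Let rho i u := radial (K i) u / vol_radius (K i).
(** The pointwise AM-GM gap for the numbers rho_i(u)^n. *)
Let defect u := (\sum_i rho i u ^+ n) / n%:R - \prod_i rho i u.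

Let rho_gt0 i u : S u -> 0 < rho i u.
Proof.
by move=> Su; rewrite divr_gt0 ?vol_radius_gt0//; case: (star_K i) => _ _ h _; exact: h.
Qed.

Let rho_cont i : {within S, continuous (rho i)}.
Proof.
apply: within_continuousM; last exact: within_continuous_cst.
by case: (star_K i).
Qed.

Let agm u : S u -> 0 <= defect u ?= iff [forall i, forall j, rho i u == rho j u].
Proof.
move=> Su; rewrite /defect.
have := @leif_AGM R 'I_n xpredT (fun i => rho i u ^+ n).
rewrite card_ord => /(_ (fun i _ => exprn_ge0 _ (ltW (rho_gt0 i Su)))).
rewrite prodrXl => h.
have s0 : 0 <= (\sum_i rho i u ^+ n) / n%:R.
  by rewrite divr_ge0// sumr_ge0// => i _; rewrite exprn_ge0// ltW// rho_gt0.
have p0 : 0 <= \prod_i rho i u by rewrite prodr_ge0// => i _; rewrite ltW// rho_gt0.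
split; first by rewrite subr_ge0 -(ler_pXn2r n_gt0) ?nnegrE// h.1.
rewrite eq_sym subr_eq0 eq_sym -(eqrXn2 n_gt0)// h.2.
apply: eq_forallb => i; apply: eq_forallb => j.
by rewrite eqrXn2// ltW// rho_gt0.
Qed.

Let defect_cont : {within S, continuous defect}.
Proof.
apply: within_continuousD.
  apply: within_continuousM; last exact: within_continuous_cst.
  by apply: within_continuous_sum => i _; exact: within_continuousX.
by apply: within_continuousN; apply: within_continuous_prod => i _.
Qed.

Let prod_gt0 : 0 < \prod_i vol_radius (K i).
Proof. by apply: prodr_gt0 => i _; exact: vol_radius_gt0. Qed.

(** By the polar formula each normalised power rho_i^n integrates to n, and so does their mean. *)
Let int_defect : sphere_integral defect =
  n%:R * (1 - dual_mixed_volume K / \prod_i vol_radius (K i)).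
Proof.
have c1 : {within S, continuous (fun u => \sum_i rho i u ^+ n)}.
  by apply: within_continuous_sum => i _; exact: within_continuousX.
have c2 : {within S, continuous (fun u => \prod_i radial (K i) u)}.
  by apply: within_continuous_prod => i _; case: (star_K i).
rewrite (@eq_sphere_integral _ _ _ (fun u => n%:R^-1 * (\sum_i rho i u ^+ n) +
   (- (\prod_i vol_radius (K i))^-1) * \prod_i radial (K i) u)); last first.
  move=> u Su; rewrite /defect mulrC; congr (_ + _).
  by rewrite /rho prodf_div mulNr mulrC.
rewrite sphere_integralD ?sphere_integralZ//; last 2 first.
- by apply: within_continuousM => //; exact: within_continuous_cst.
- by apply: within_continuousM => //; exact: within_continuous_cst.
rewrite sphere_integral_sum; last by move=> i; exact: within_continuousX.
rewrite (eq_bigr (fun=> n%:R)); last first.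
  move=> i _.
  rewrite (@eq_sphere_integral _ _ _ (fun u => (volume (K i))^-1 * radial (K i) u ^+ n)).
    rewrite sphere_integralZ; last by apply: within_continuousX; case: (star_K i).
    by rewrite volume_polar// mulrCA mulVf ?mulr1// gt_eqF// volume_gt0.
  by move=> u _; rewrite /rho expr_div_n vol_radiusX// mulrC.
rewrite sumr_const card_ord -[n%:R *+ n]mulr_natr mulKf// mulrBr mulr1; congr (_ + _).
by rewrite /dual_mixed_volume; field; rewrite n0 gt_eqF.
Qed.

Lemma dual_minkowski : dual_mixed_volume K <= \prod_i vol_radius (K i).
Proof.
have : 0 <= sphere_integral defect.
  by apply: sphere_integral_ge0 => u Su; exact: (agm Su).1.
rewrite int_defect pmulr_rge0 ?ltr0n// subr_ge0 ler_pdivrMr//.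
by rewrite mul1r.
Qed.

Lemma dual_minkowski_eq : dual_mixed_volume K = \prod_i vol_radius (K i) <->
  forall i j, dilates (K i) (K j).
Proof.
split=> [E i j|dil].
  have : sphere_integral defect = 0 by rewrite int_defect E divff ?subrr ?mulr0// gt_eqF.
  move/(sphere_integral_eq0 defect_cont (fun u Su => (agm Su).1)) => D0.
  (* Vanishing of the gap makes all normalised radial functions equal, so the dilation factor is the
     ratio of the normalisations. *)
  exists (vol_radius (K i) / vol_radius (K j)) => u Su.
  have /forallP/(_ i)/forallP/(_ j)/eqP : [forall i, forall j, rho i u == rho j u].
    by rewrite -(agm Su).2 D0.
  have rj : 0 < radial (K j) u by case: (star_K j) => _ _ h _; exact: h.
  rewrite /rho => /(congr1 (fun x => x * vol_radius (K i) / radial (K j) u)).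
  rewrite divfK ?gt_eqF ?vol_radius_gt0// => ->.
  by field; rewrite !gt_eqF ?vol_radius_gt0.
have : sphere_integral defect = 0.
  rewrite (@eq_sphere_integral _ _ _ (fun u => 0 * defect u)) ?sphere_integralZ ?mul0r//.
  move=> u Su; rewrite mul0r; apply/esym/eqP; rewrite (agm Su).2.
  apply/forallP => i; apply/forallP => j; apply/eqP.
  have /(dilates_radial (star_K i) (star_K j))[c c0 cP] := dil i j.
  rewrite /rho (vol_radius_dilate (star_K i) (star_K j) c0 cP) cP//.
  by rewrite -mulf_div divff ?mul1r// gt_eqF.
rewrite int_defect => /eqP; rewrite mulf_eq0 (negbTE n0)/= subr_eq0 => /eqP E.
by rewrite -[RHS]mul1r [X in X * _]E divfK// gt_eqF.
Qed.

End DualMinkowski.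

(** * The Orlicz inequality *)

Section OrliczMinkowski.
Context {R : realType} {n : nat}.
Local Notation S := (@unit_sphere R n).
Hypothesis n_gt0 : (0 < n)%N.
Variables (L1 : set 'rV[R]_n) (K : 'I_n -> set 'rV[R]_n) (phi : R -> R).
Hypotheses (star_L1 : star_body L1) (star_K : forall i, star_body (K i)).
Hypothesis phi_C : class_C phi.
Variable i1 : 'I_n.

Definition replace_body (X : set 'rV[R]_n) (i : 'I_n) : set 'rV[R]_n :=
  if i == i1 then X else K i.

Let mixed X := dual_mixed_volume (replace_body X).
Let M := orlicz_sum phi (K i1) L1.
Let Q u := \prod_(i | i != i1) radial (K i) u.

Let radial_gt0 (X : set 'rV[R]_n) u : star_body X -> S u -> 0 < radial X u.
Proof. by move=> [_ _ h _]; exact: h. Qed.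

Let star_M : star_body M. Proof. exact: (is_orlicz_sumP phi_C (star_K i1) star_L1).1. Qed.

Let M_eq u : S u -> phi (radial (K i1) u / radial M u) + phi (radial L1 u / radial M u) = phi 1.
Proof. exact: (is_orlicz_sumP phi_C (star_K i1) star_L1).2. Qed.

Let star_replace X i : star_body X -> star_body (replace_body X i).
Proof. by rewrite /replace_body; case: ifP. Qed.

Let replace_id : replace_body (K i1) = K.
Proof. by apply/funext => i; rewrite /replace_body; case: eqP => [->|]. Qed.

Let Q_gt0 u : S u -> 0 < Q u.
Proof. by move=> Su; apply: prodr_gt0 => i _; exact: radial_gt0. Qed.

Let cont_mixed X : star_body X -> {within S, continuous (fun u => radial X u * Q u)}.
Proof.
move=> [_ _ _ cX]; apply: within_continuousM => //.
by apply: within_continuous_prod => i _; case: (star_K i).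
Qed.

Let mixedE X : mixed X = n%:R^-1 * sphere_integral (fun u => radial X u * Q u).
Proof.
rewrite /mixed /dual_mixed_volume; congr (_ * _); apply: eq_sphere_integral => u _.
rewrite (bigD1 i1)//= /replace_body eqxx; congr (_ * _).
by apply: eq_bigr => i /negbTE ->.
Qed.

Let mixed_gt0 X : star_body X -> 0 < mixed X.
Proof.
move=> sX; rewrite mixedE mulr_gt0 ?invr_gt0 ?ltr0n//.
have [u Su] := @unit_sphere_nonempty R n n_gt0.
apply: (sphere_integral_gt0 n_gt0 (cont_mixed sX) _ Su).
  by move=> v Sv; rewrite ltW// mulr_gt0 ?radial_gt0 ?Q_gt0.
by rewrite mulr_gt0 ?radial_gt0 ?Q_gt0.
Qed.

Let W := mixed M.
Let W_gt0 : 0 < W. Proof. exact: mixed_gt0. Qed.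
Let m1 := mixed (K i1) / W.
Let m2 := mixed L1 / W.
Let m1_gt0 : 0 < m1. Proof. by rewrite divr_gt0 ?mixed_gt0. Qed.
Let m2_gt0 : 0 < m2. Proof. by rewrite divr_gt0 ?mixed_gt0. Qed.

(** * The integrated tangent gap *)

Section Gap.
Variables s1 s2 : R.
Hypothesis s1P : forall x, 0 < x -> phi m1 + s1 * (x - m1) <= phi x.
Hypothesis s2P : forall x, 0 < x -> phi m2 + s2 * (x - m2) <= phi x.

(** This expanded form is integrated term by term; [gapE] rewrites it as the sum of the two tangent
    gaps with the positive weight rho_M Q. *)
Let gap u := (phi 1 - phi m1 - phi m2) * (radial M u * Q u)
  + (- s1) * (radial (K i1) u * Q u - m1 * (radial M u * Q u))
  + (- s2) * (radial L1 u * Q u - m2 * (radial M u * Q u)).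

Let gapE u : S u -> gap u =
  (phi (radial (K i1) u / radial M u) - (phi m1 + s1 * (radial (K i1) u / radial M u - m1))
  + (phi (radial L1 u / radial M u) - (phi m2 + s2 * (radial L1 u / radial M u - m2))))
  * (radial M u * Q u).
Proof.
by move=> Su; rewrite /gap -(M_eq Su); field; rewrite gt_eqF// radial_gt0.
Qed.

Let gap_ge0 u : S u -> 0 <= gap u.
Proof.
move=> Su; have Mu := radial_gt0 star_M Su.
rewrite gapE// mulr_ge0//; last by rewrite ltW// mulr_gt0// Q_gt0.
by rewrite addr_ge0// subr_ge0; [apply: s1P|apply: s2P]; rewrite divr_gt0// radial_gt0.
Qed.

Let cM := cont_mixed star_M.

Let cZ c (f : 'rV[R]_n -> R) : {within S, continuous f} ->
  {within S, continuous (fun u => c * f u)}.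
Proof. by apply: within_continuousM; exact: within_continuous_cst. Qed.

Let cB X m : star_body X ->
  {within S, continuous (fun u => radial X u * Q u - m * (radial M u * Q u))}.
Proof.
move=> sX; apply: within_continuousD; first exact: cont_mixed.
by apply: within_continuousN; exact: cZ.
Qed.

Let gap_cont : {within S, continuous gap}.
Proof.
apply: within_continuousD; last by apply: cZ; exact: cB.
by apply: within_continuousD; apply: cZ => //; exact: cB.
Qed.

(** The constant [mixed X / W] is the mean of rho_X / rho_M for the weight rho_M Q, so deviations
    from it integrate to zero. *)
Let int_B X : star_body X ->
  sphere_integral (fun u => radial X u * Q u - mixed X / W * (radial M u * Q u)) = 0.
Proof.
move=> sX; rewrite (@eq_sphere_integral _ _ _
  (fun u => radial X u * Q u + (- (mixed X / W)) * (radial M u * Q u))); last first.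
  by move=> u _; rewrite mulNr.
rewrite sphere_integralD; [|exact: cont_mixed|exact: cZ].
rewrite sphere_integralZ//.
have n0 : (n%:R : R) != 0 by rewrite pnatr_eq0 -lt0n.
have E Y : sphere_integral (fun u => radial Y u * Q u) = n%:R * mixed Y.
  by rewrite mixedE mulrA mulfV// mul1r.
by rewrite !E -/W; field; rewrite gt_eqF.
Qed.

Let int_gap : sphere_integral gap = (phi 1 - phi m1 - phi m2) * (n%:R * W).
Proof.
have n0 : (n%:R : R) != 0 by rewrite pnatr_eq0 -lt0n.
rewrite /gap sphere_integralD; last by apply: cZ; exact: cB.
rewrite sphere_integralD; [|exact: cZ|by apply: cZ; exact: cB].
  rewrite !sphere_integralZ//; [|exact: cB|exact: cB].
  rewrite !int_B// !mulr0 !addr0; congr (_ * _).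
  by rewrite /W mixedE mulrA mulfV// mul1r.
by apply: within_continuousD; apply: cZ => //; exact: cB.
Qed.

Lemma orlicz_gap_ge0 : phi m1 + phi m2 <= phi 1.
Proof.
have := sphere_integral_ge0 gap_ge0; rewrite int_gap pmulr_lge0.
  by rewrite -addrA -opprD subr_ge0.
by rewrite mulr_gt0// ltr0n.
Qed.

(** The two tangent gaps are nonnegative with vanishing sum, so both vanish in every direction, and
    strict convexity allows contact only at the tangent point. *)
Lemma orlicz_gap_eq0 : strictly_convex_function `]0, +oo[ phi ->
  phi m1 + phi m2 = phi 1 ->
  forall u, S u -> radial (K i1) u / radial M u = m1 /\ radial L1 u / radial M u = m2.
Proof.
move=> sc E u Su; have Mu := radial_gt0 star_M Su.
have I0 : sphere_integral gap = 0 by rewrite int_gap -E; ring.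
move: (sphere_integral_eq0 n_gt0 gap_cont gap_ge0 I0 Su).
have MQ : 0 < radial M u * Q u by rewrite mulr_gt0// Q_gt0.
rewrite gapE// => /eqP; rewrite mulf_eq0 [X in _ || X]gt_eqF// orbF.
set x := radial (K i1) u / radial M u; set y := radial L1 u / radial M u.
have x0 : 0 < x by rewrite divr_gt0// radial_gt0.
have y0 : 0 < y by rewrite divr_gt0// radial_gt0.
move=> /eqP h; have h1 := s1P x0; have h2 := s2P y0.
split; apply/eqP; apply: contraT => ne; exfalso.
  by have := class_C_tangent_lt m1_gt0 s1P sc x0 ne; lra.
by have := class_C_tangent_lt m2_gt0 s2P sc y0 ne; lra.
Qed.

End Gap.

(** * The inequality and its equality case *)

Let P X := \prod_i vol_radius (replace_body X i).

Let P_gt0 X : star_body X -> 0 < P X.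
Proof. by move=> sX; apply: prodr_gt0 => i _; apply: vol_radius_gt0 => //; exact: star_replace. Qed.

Lemma volume_quotientE X : star_body X ->
  (volume X * (\prod_(i < n | i != i1) volume (K i)) / W ^+ n) `^ n%:R^-1 = P X / W.
Proof.
move=> sX; have n0 : (n%:R : R) != 0 by rewrite pnatr_eq0 -lt0n.
have -> : volume X * (\prod_(i < n | i != i1) volume (K i)) = P X ^+ n.
  rewrite /P -prodrXl [RHS](bigD1 i1)//=; congr (_ * _).
    by rewrite /replace_body eqxx vol_radiusX.
  apply: eq_bigr => i /negbTE ii; rewrite /replace_body ii vol_radiusX//.
have PW : 0 <= P X / W by rewrite divr_ge0 ?ltW ?P_gt0.
by rewrite -expr_div_n -powR_mulrn// -powRrM mulfV// powRr1.
Qed.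

Let quotient_le X : star_body X -> mixed X / W <= P X / W.
Proof.
move=> sX; rewrite ler_pM2r ?invr_gt0//; apply: dual_minkowski => // i.
exact: star_replace.
Qed.

Let phi_quotient_le X : star_body X -> phi (P X / W) <= phi (mixed X / W).
Proof. by move=> sX; apply: class_C_le => //; [rewrite divr_gt0 ?mixed_gt0|exact: quotient_le]. Qed.

Lemma orlicz_minkowski_le : phi (P (K i1) / W) + phi (P L1 / W) <= phi 1.
Proof.
have [s1 s1P] := class_C_tangent phi_C m1_gt0.
have [s2 s2P] := class_C_tangent phi_C m2_gt0.
by apply: le_trans (orlicz_gap_ge0 s1P s2P); apply: lerD; exact: phi_quotient_le.
Qed.

(** The values at the volume quotients, the values at m_1 and m_2, and phi 1 form a chain of
    inequalities; equality of its ends forces equality throughout. *)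
Lemma orlicz_minkowski_dilates : strictly_convex_function `]0, +oo[ phi ->
  phi 1 = phi (P (K i1) / W) + phi (P L1 / W) ->
  (forall i, dilates L1 (K i)) /\ (forall i j, dilates (K i) (K j)).
Proof.
move=> sc E.
have [s1 s1P] := class_C_tangent phi_C m1_gt0.
have [s2 s2P] := class_C_tangent phi_C m2_gt0.
have g := orlicz_gap_ge0 s1P s2P.
have q1 : phi (P (K i1) / W) <= phi m1 := phi_quotient_le (star_K i1).
have q2 : phi (P L1 / W) <= phi m2 := phi_quotient_le star_L1.
have e1 : phi (P (K i1) / W) = phi m1 by lra.
have e2 : phi m1 + phi m2 = phi 1 by lra.
have dK : forall i j, dilates (K i) (K j).
  have : mixed (K i1) = P (K i1).
    apply/eqP; rewrite eq_le; apply/andP; split.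
      by move: (quotient_le (star_K i1)); rewrite ler_pM2r ?invr_gt0.
    (* Strict decrease of phi turns the equality [e1] of values into equality of arguments. *)
    rewrite leNgt; apply/negP => lt.
    have : m1 < P (K i1) / W by rewrite ltr_pM2r ?invr_gt0.
    by move=> /(class_C_lt phi_C m1_gt0); rewrite e1 ltxx.
  rewrite /mixed /P replace_id => /(dual_minkowski_eq n_gt0); exact.
split=> // i; apply/dilates_radial => //.
have /dilates_radial[//|//|//|c c0 cP] := dK i1 i.
(* Here m_2 / m_1 is the constant ratio of rho_{L_1} to rho_{K_1}, and c that of rho_{K_1} to
   rho_{K_i}. *)
exists (m2 / m1 * c); first by rewrite mulr_gt0// divr_gt0.
move=> u Su; have [h1 h2] := orlicz_gap_eq0 s1P s2P sc e2 Su.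
have Mu := radial_gt0 star_M Su.
have -> : m2 / m1 * c * radial (K i) u = m2 / m1 * radial (K i1) u.
  by rewrite (cP u Su) mulrA.
have Ku := radial_gt0 (star_K i1) Su.
by rewrite -h1 -h2; field; rewrite !gt_eqF.
Qed.

Lemma orlicz_minkowski_eq :
  (forall i, dilates L1 (K i)) -> (forall i j, dilates (K i) (K j)) ->
  phi 1 = phi (P (K i1) / W) + phi (P L1 / W).
Proof.
move=> dL dK; have [u0 Su0] := @unit_sphere_nonempty R n n_gt0.
have mixedP X : star_body X -> (forall i, dilates X (K i)) -> mixed X = P X.
  move=> sX dX; apply/(dual_minkowski_eq n_gt0) => [i|i j]; first exact: star_replace.
  rewrite /replace_body; case: eqP => _; case: eqP => _ //.
    by exists 1 => u Su; rewrite divff// gt_eqF// radial_gt0.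
  exact: dilates_sym.
have /(dilates_radial n_gt0 star_L1 (star_K i1))[c c0 cP] := dL i1.
(* With l = rho_{K_1}(u) / rho_{K_1}(v), both radii at u are l times those at v, since L_1 is a
   dilate of K_1; the root at u is then at most l times the root at v. Exchanging u and v will give
   equality. *)
have Mratio u v : S u -> S v -> radial M u * radial (K i1) v <= radial (K i1) u * radial M v.
  move=> Su Sv; have Ku := radial_gt0 (star_K i1) Su; have Kv := radial_gt0 (star_K i1) Sv.
  have Mu := radial_gt0 star_M Su; have Mv := radial_gt0 star_M Sv.
  have Lu := radial_gt0 star_L1 Su; have Lv := radial_gt0 star_L1 Sv.
  rewrite -ler_pdivlMr// mulrAC.
  apply: (orlicz_root_le phi_C Kv Lv Mv Ku Lu Mu _ (M_eq Sv) (M_eq Su)).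
  - by rewrite divr_gt0.
  - by rewrite divfK// gt_eqF.
  - by rewrite !cP// mulrCA divfK// gt_eqF.
pose t := radial (K i1) u0 / radial M u0.
have Kt u : S u -> radial (K i1) u = t * radial M u.
  move=> Su; have Mu0 := radial_gt0 star_M Su0.
  have e : radial M u * radial (K i1) u0 = radial (K i1) u * radial M u0.
    apply/eqP; rewrite eq_le Mratio//=.
    by rewrite mulrC [leRHS]mulrC Mratio.
  by rewrite /t mulrAC [X in X / _]mulrC e mulfK// gt_eqF.
have mixedZ X a : (forall u, S u -> radial X u = a * radial M u) -> mixed X / W = a.
  move=> XM; rewrite mixedE (@eq_sphere_integral _ _ _ (fun u => a * (radial M u * Q u))).
    rewrite sphere_integralZ; last exact: cont_mixed.
    rewrite mulrCA (_ : _ * sphere_integral _ = W); first by rewrite mulfK// gt_eqF.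
    by rewrite /W mixedE.
  by move=> u Su; rewrite XM// mulrA.
(* Both quotients are now the constant ratios to rho_M, and the goal is the defining relation of M
   at [u0]. *)
rewrite -!mixedP// (mixedZ _ t Kt) (mixedZ _ (c * t)) => [|u Su]; last first.
  by rewrite cP// Kt// mulrA.
rewrite -(M_eq Su0); congr (_ + phi _).
by rewrite cP// /t mulrA.
Qed.

End OrliczMinkowski.

Unset Implicit Arguments.

Theorem corollary6p6 (R : realType) (n : nat) (n_gt0 : (0 < n)%N)
    (L1 : set 'rV[R]_n) (K : 'I_n -> set 'rV[R]_n) (phi : R -> R)
    (star_L1 : star_body L1) (star_K : forall i, star_body (K i))
    (phi_C : class_C phi) :
  let i1 : 'I_n := Ordinal n_gt0 in
  let W := dual_mixed_volume
    (fun i => if i == i1 then orlicz_sum phi (K i1) L1 else K i) in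
  let rhs :=
    phi (((\prod_(i < n) volume (K i)) / W ^+ n) `^ n%:R^-1) +
    phi ((volume L1 * (\prod_(i < n | i != i1) volume (K i)) / W ^+ n)
           `^ n%:R^-1) in
  phi 1 >= rhs /\
  (strictly_convex_function `]0, +oo[ phi ->
    (phi 1 = rhs <->
      (forall i, dilates L1 (K i)) /\ (forall i j, dilates (K i) (K j)))).
Proof.
move=> i1 W rhs.
have -> : rhs = phi (\prod_i vol_radius (replace_body K i1 (K i1) i) / W) +
    phi (\prod_i vol_radius (replace_body K i1 L1 i) / W).
  (* Splitting off the factor at [i1] gives both quotients the shape of [volume_quotientE]. *)
  rewrite /rhs (bigD1 i1)//=.
  by rewrite -!(volume_quotientE n_gt0 star_L1 star_K phi_C i1).
split; first exact: orlicz_minkowski_le.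
move=> sc; split; first exact: orlicz_minkowski_dilates.
by move=> [dL dK]; exact: orlicz_minkowski_eq.
Qed.
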